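(* Let $N=2$ and let $F\in GL_2(\mathbb C)$ satisfy $F\overline F=\varepsilon I_2$ for some $\varepsilon\in\{\pm1\}$ and $F^*F=I_2$. If $u=u^*\in\operatorname{Pol}(O_F^+)$ and $h(u)=0$, define $S,Q\geq 0$ by $$S^2=h(u^2),\qquad Q^2=h\bigl(u(L-I)u\bigr).$$ Then $$|h(u^3)|\leq 3S^2Q+Q^3.$$
   Context: Let $N\ge 2$ and $F\in GL_N(\mathbb C)$ with $F\overline F=\pm I_N$ and $F^*F=I_N$ ($\overline F$ is the entrywise complex conjugate); here $N=2$. The free orthogonal quantum group $O_F^+$ is the compact quantum group whose $C^*$-algebra $C(O_F^+)$ is the universal unital $C^*$-algebra generated by the entries of a unitary matrix $u^1=(u^1_{ij})_{1\le i,j\le N}$ subject to $u^1=F\,\overline{u^1}\,F^{-1}$, where $\overline{u^1}=((u^1_{ij})^* )$, with coproduct $\Delta(u^1_{ij})=\sum_{k}u^1_{ik}\otimes u^1_{kj}$. Since $F$ is unitary, $O_F^+$ is of Kac type: its Haar state $h$ is a trace. $L_2(O_F^+)$ is the GNS Hilbert space of $h$, with $\|x\|_2=h(x^*x)^{1/2}$. The irreducible unitary representations of $O_F^+$ are, up to equivalence, $u^k=(u^k_{ij})_{1\le i,j\le d_k}$, $k\in\mathbb N_0=\{0,1,2,\dots\}$, with $u^0=\mathbf 1$, $u^1$ the fundamental representation above, and fusion rules $u^i\otimes u^j\simeq u^{|i-j|}\oplus u^{|i-j|+2}\oplus\cdots\oplus u^{i+j}$. $\operatorname{Pol}(O_F^+)$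 is the linear span of all $u^k_{ij}$ (a $*$-algebra). Put $V_k=\operatorname{span}\{u^k_{ij}:1\le i,j\le d_k\}$; then $L_2(O_F^+)=\bigoplus_{k\ge0}V_k$ orthogonally. The monic Chebyshev polynomials of the second kind are $U_0(x)=1$, $U_1(x)=x$, $U_{k+1}(x)=xU_k(x)-U_{k-1}(x)$; one has $d_k=U_k(N)$. Put $\alpha_k=N\,U_k'(N)/U_k(N)$; for $N=2$ this gives $d_k=k+1$ and $\alpha_k=k(k+2)/3$. $L$ is the nonnegative self-adjoint operator on $L_2(O_F^+)$ with $L|_{V_k}=\alpha_k I_{V_k}$; it maps $\operatorname{Pol}(O_F^+)$ to itself. Since $\alpha_k\ge 1$ for all $k\ge1$, $h(u(L-I)u)\ge0$ for self-adjoint $u\in\operatorname{Pol}(O_F^+)$ with $h(u)=0$. The element $u$ in the statement is an arbitrary element of $\operatorname{Pol}(O_F^+)$, not a representation matrix. *)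

(* Defs.v *)
From HB Require Import structures.
From mathcomp Require Import all_boot all_order all_algebra.
From mathcomp Require Import reals complex mxtens ring.

Set Implicit Arguments.
Unset Strict Implicit.
Unset Printing Implicit Defensive.

Import Order.TTheory GRing.Theory Num.Theory.

Local Open Scope ring_scope.
Local Open Scope complex_scope.

(* The library has normed modules but no normed algebras, so the complete norm
   is part of the mixin; it takes its values in R. The ring structure of an
   algType is nontrivial, so the zero algebra is excluded. *)
HB.mixin Record isCStarAlgebra (R : realType) A of GRing.Algebra R[i] A := {
  star : A -> A;
  cnorm : A -> R;
  starK : involutive star;
  star_semilinear : forall (a : R[i]) (x y : A),
    star (a *: x + y) = Num.conj a *: star x + star y;
  starM : forall x y : A, star (x * y) = star y * star x;
  cnorm_eq0 : forall x : A, cnorm x = 0 -> x = 0;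
  cnormD : forall x y : A, cnorm (x + y) <= cnorm x + cnorm y;
  cnormZ : forall (a : R[i]) (x : A),
    (cnorm (a *: x))%:C = `|a| * (cnorm x)%:C;
  cnormM : forall x y : A, cnorm (x * y) <= cnorm x * cnorm y;
  cnorm_star : forall x : A, cnorm (star x * x) = cnorm x ^+ 2;
  cnorm_complete : forall x : nat -> A,
    (forall e : R, 0 < e -> exists n0, forall m n : nat,
       (n0 <= m)%N -> (n0 <= n)%N -> cnorm (x m - x n) < e) ->
    exists l : A, forall e : R, 0 < e -> exists n0, forall n : nat,
       (n0 <= n)%N -> cnorm (x n - l) < e
}.

#[short(type="cstarAlgType")]
HB.structure Definition CStarAlgebra (R : realType) :=
  {A of GRing.Algebra R[i] A & isCStarAlgebra R A}.

Section CStarMatrices.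
Variables (R : realType) (A : cstarAlgType R).

Definition star_hom (B : cstarAlgType R) (f : {lrmorphism A -> B}) : Prop :=
  forall x, f (star x) = star (f x).

(* A scalar matrix acting on matrices over A. *)
Definition inmx m n (M : 'M[R[i]]_(m, n)) : 'M[A]_(m, n) :=
  map_mx (in_alg A) M.

Definition conjmx n (v : 'M[A]_n) : 'M[A]_n := map_mx (@star R A) v.

Definition unitary n (v : 'M[A]_n) : Prop :=
  v *m (conjmx v)^T = 1%:M /\ (conjmx v)^T *m v = 1%:M.

Definition intertwiner m n (v : 'M[A]_m) (w : 'M[A]_n)
    (X : 'M[R[i]]_(m, n)) : Prop :=
  v *m inmx X = inmx X *m w.

Definition equivalent m n (v : 'M[A]_m) (w : 'M[A]_n) : Prop :=
  exists (X : 'M[R[i]]_(m, n)) (Y : 'M[R[i]]_(n, m)),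
    [/\ X *m Y = 1%:M, Y *m X = 1%:M & intertwiner v w X].

Definition irreducible n (v : 'M[A]_n) : Prop :=
  (0 < n)%N /\ forall X, intertwiner v v X -> exists c, X = c%:M.

End CStarMatrices.

Section FreeOrthogonal.
Variables (R : realType) (N : nat) (F : 'M[R[i]]_N).

Definition OF_relations (A : cstarAlgType R) (u : 'M[A]_N) : Prop :=
  unitary u /\ u = inmx A F *m conjmx u *m inmx A (invmx F).

(* (A, u) is C(O_F^+) with its fundamental matrix; the pair is determined by
   this property up to a unique isomorphism. *)
Definition universal_OF (A : cstarAlgType R) (u : 'M[A]_N) : Prop :=
  OF_relations u /\
  forall (B : cstarAlgType R) (v : 'M[B]_N), OF_relations v ->
    exists f : {lrmorphism A -> B},
      [/\ star_hom f, map_mx f u = v &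
        forall g : {lrmorphism A -> B},
          star_hom g -> map_mx g u = v -> g =1 f].

End FreeOrthogonal.

Section MinimalTensor.
Variables (R : realType) (A B : cstarAlgType R).

Definition lin_indep n (b : 'I_n -> B) : Prop :=
  forall c : 'I_n -> R[i], \sum_k c k *: b k = 0 -> forall k, c k = 0.

Definition tensor_sum (T : cstarAlgType R) (i1 : A -> T) (i2 : B -> T)
    n (a : 'I_n -> A) (b : 'I_n -> B) : T :=
  \sum_k i1 (a k) * i2 (b k).

(* i1 and i2 are commuting unital *-homomorphisms, and the induced map from
   the algebraic tensor product of A and B to T is injective; the norm of T
   then restricts to a C*-norm on that tensor product, and every C*-norm on it
   arises in this way. *)
Definition cstar_tensor (T : cstarAlgType R)
    (i1 : {lrmorphism A -> T}) (i2 : {lrmorphism B -> T}) : Prop :=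
  [/\ star_hom i1, star_hom i2, forall a b, i1 a * i2 b = i2 b * i1 a &
    forall n (a : 'I_n -> A) (b : 'I_n -> B),
      lin_indep b -> tensor_sum i1 i2 a b = 0 -> forall k, a k = 0].

(* The completion of the algebraic tensor product for its least C*-norm. *)
Definition min_tensor (T : cstarAlgType R)
    (i1 : {lrmorphism A -> T}) (i2 : {lrmorphism B -> T}) : Prop :=
  [/\ cstar_tensor i1 i2,
    forall (t : T) (e : R), 0 < e ->
      exists n (a : 'I_n -> A) (b : 'I_n -> B),
        cnorm (t - tensor_sum i1 i2 a b) < e &
    forall (T' : cstarAlgType R)
      (j1 : {lrmorphism A -> T'}) (j2 : {lrmorphism B -> T'}),
      cstar_tensor j1 j2 ->
      forall n (a : 'I_n -> A) (b : 'I_n -> B),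
        cnorm (tensor_sum i1 i2 a b) <= cnorm (tensor_sum j1 j2 a b)].

End MinimalTensor.

Section QuantumGroup.
(* AA with i1 and i2 stands for the minimal tensor square of A. *)
Variables (R : realType) (A AA : cstarAlgType R).
Variables (i1 i2 Delta : {lrmorphism A -> AA}).

(* Entrywise, Delta (v i j) is the sum over k of v i k (x) v k j. *)
Definition corep n (v : 'M[A]_n) : Prop :=
  map_mx Delta v = map_mx i1 v *m map_mx i2 v.

Definition unitary_rep n (v : 'M[A]_n) : Prop := unitary v /\ corep v.

Definition state (h : {scalar A}) : Prop :=
  h 1 = 1 /\ forall x, 0 <= h (star x * x).

Definition bounded_linear (E : {linear AA -> A}) : Prop :=
  exists K : R, forall t, cnorm (E t) <= K * cnorm t.

(* E1 and E2 are the slice maps h (x) id and id (x) h. *)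
Definition haar_state (h : {scalar A}) : Prop :=
  state h /\
  exists E1 E2 : {linear AA -> A},
    [/\ bounded_linear E1 /\ bounded_linear E2,
        forall a b, E1 (i1 a * i2 b) = h a *: b,
        forall a b, E2 (i1 a * i2 b) = h b *: a &
        forall x, E1 (Delta x) = (h x)%:A /\ E2 (Delta x) = (h x)%:A].

(* The irreducible unitary representations of O_F^+ for N = 2, numbered by the
   fusion rules. The dimension d_k = U_k(2) is k + 1, see chebU_at2 below, and
   the block with number l on the right-hand side of the fusion rule is
   u^(|i - j| + 2 l). *)
Definition irreps (u1 : 'M[A]_2) (U : forall k, 'M[A]_k.+1) : Prop :=
  [/\ U 0%N = 1%:M /\ U 1%N = u1,
      forall k, unitary_rep (U k) /\ irreducible (U k),
      forall k l, equivalent (U k) (U l) -> k = l,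
      forall n (v : 'M[A]_n), unitary_rep v -> irreducible v ->
        exists k, equivalent v (U k) &
      forall i j, equivalent (U i *t U j)
        (\mxdiag_(l < (minn i j).+1) U ((i - j) + (j - i) + l.*2)%N)].

End QuantumGroup.

Section Coefficients.
Variables (R : realType) (A : cstarAlgType R) (U : forall k, 'M[A]_k.+1).

Definition coef k (c : 'M[R[i]]_k.+1) : A := \sum_i \sum_j c i j *: U k i j.

Definition V k (x : A) : Prop := exists c : 'M_k.+1, x = coef c.

Definition Pol (x : A) : Prop :=
  exists n (c : forall k, 'M[R[i]]_k.+1), x = \sum_(k < n) coef (c k).

End Coefficients.

Fixpoint chebU (K : fieldType) (k : nat) : {poly K} :=
  match k with
  | 0 => 1
  | k1.+1 => match k1 with
             | 0 => 'X
             | k2.+1 => 'X * chebU K k1 - chebU K k2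
             end
  end.

Definition alpha (K : fieldType) (N k : nat) : K :=
  N%:R * (chebU K k)^`().[N%:R] / (chebU K k).[N%:R].

Lemma chebU_at2 (K : numFieldType) k :
  (chebU K k).[2] = k.+1%:R /\
  (chebU K k)^`().[2] = k%:R * k.+1%:R * k.+2%:R / 6.
Proof.
suff H : forall k, let P k := (chebU K k).[2] = k.+1%:R /\
  (chebU K k)^`().[2] = k%:R * k.+1%:R * k.+2%:R / 6 in P k /\ P k.+1.
  by case: (H k).
elim=> [|n /= [[Pn Dn] [PSn DSn]]] /=.
  rewrite derivX derivC !hornerE; do !split=> //=; try by field.
do !split=> //.
  by rewrite hornerD hornerN hornerM hornerX PSn Pn -!natr1; ring.
rewrite derivB derivM derivX mul1r hornerD hornerN hornerD hornerM hornerX.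
by rewrite PSn DSn Dn -!natr1; field.
Qed.

Lemma alpha2E (K : numFieldType) k : alpha K 2 k = k%:R * k.+2%:R / 3.
Proof.
rewrite /alpha; have [-> ->] := chebU_at2 K k.
by field; rewrite nat1r pnatr_eq0.
Qed.

(* The restriction of L to Pol(O_F^+), which L maps to itself; the values of L
   outside Pol U are irrelevant. *)
Definition is_L (R : realType) (A : cstarAlgType R) (N : nat)
    (U : forall k, 'M[A]_k.+1) (L : A -> A) : Prop :=
  (forall (a : R[i]) x y, Pol U x -> Pol U y ->
     L (a *: x + y) = a *: L x + L y) /\
  (forall k x, V U k x -> L x = alpha R[i] N k *: x).

(* Main.v *)
(* Write u as the sum of its self-adjoint components u_k in V_k, k >= 1, and put
   a_k = |u_k|_2, so that S^2 = sum a_k^2 and Q^2 = sum (k - 1)(k + 3)/3 a_k^2.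
   Two bounds control the terms t(i,j,k) = Re h(u_i u_j u_k) of h(u^3). First,
   u^i (x) u^j contains u^k at most once, so Schur orthogonality gives
   |t(i,j,k)|^2 <= d_i d_j / d_k (a_i a_j a_k)^2, and t(i,j,k) = 0 unless the
   fusion rules allow it. Second, left multiplication by u_i has norm at most
   d_i a_i on L_2. Orthogonality needs the Haar state to be a trace on Pol: the
   conjugate of each u^k is unitary, by induction along u^k (x) u^1.
   What remains is an inequality for the array t. Only t(1,1,2) is nearly
   critical: 3 t(1,1,2) <= 2 sqrt 3 a_1^2 a_2 against 3 a_1^2 Q, where
   Q >= sqrt (5/3) a_2. The terms without index 1 are at most
   Q^3 + (8/5) a_2^2 Q, and what is left of 3 S^2 Q absorbs the terms with
   exactly one index 1. *)
Require Import Defs.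
From HB Require Import structures.
From mathcomp Require Import all_boot all_order all_algebra.
From mathcomp Require Import reals complex mxtens ring lra zify.

Set Implicit Arguments.
Unset Strict Implicit.
Unset Printing Implicit Defensive.

Import Order.TTheory GRing.Theory Num.Theory.

Local Open Scope ring_scope.
Local Open Scope complex_scope.

(* mathcomp's mxred has another conjmx. *)
Local Notation conjmx := Defs.conjmx.

(** The obstacle is the index 1: the eigenvalue of [L - I] on [V 1] is zero, so [Q] gives no control
    of a_1, and every term containing the index 1 must be paid for by 3 S^2 Q. The terms without it
    are left to Q^3, apart from a share 8/5 of the coefficient 3 of a_2^2 Q. Neither bound on the
    terms suffices alone. The Schur bound is good for a single term but loses too much when summed
    over two indices; the operator bound sums over two indices at once but costs the full d_i a_i.
    So the triples are sorted by their smallest index: the Schur bound serves finitely many terms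
    with small indices, the operator bound the rest. The tail converges because the eigenvalues of
    [L - I] grow like k^2/3 while d_k = k + 1. Decimals such as 1155/1000 or 1733/1000 in the bounds
    of single terms are sqrt (d_i d_j / d_k) rounded up. All inequalities are homogeneous of degree
    3, so they become polynomial once the square roots are replaced by linear minorants. *)

Lemma eq_by_sub (V : zmodType) (a b c d : V) :
  a - b = c - d -> c = d -> a = b.
Proof. by move=> E cd; apply/eqP; rewrite -subr_eq0 E cd subrr. Qed.

(** * Complex conjugation and Cauchy-Schwarz *)

Section Conj.
Variable K : numClosedFieldType.
Implicit Types a b : K.

Lemma cjD a b : Num.conj (a + b) = Num.conj a + Num.conj b.
Proof. exact: rmorphD. Qed.

Lemma cjM a b : Num.conj (a * b) = Num.conj a * Num.conj b.
Proof. exact: rmorphM. Qed.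

Lemma cjN a : Num.conj (- a) = - Num.conj a.
Proof. exact: rmorphN. Qed.

Lemma cj_ge0 a : 0 <= a -> Num.conj a = a.
Proof. by move=> a0; apply: conj_Creal; apply: ger0_real. Qed.

Lemma cj_sum I (r : seq I) (P : pred I) (F : I -> K) :
  Num.conj (\sum_(i <- r | P i) F i) = \sum_(i <- r | P i) Num.conj (F i).
Proof. exact: rmorph_sum. Qed.

End Conj.

Section CauchySchwarz.
Variable K : numClosedFieldType.
Implicit Types a b c : K.

Lemma quad_CS (X Y c : K) : 0 <= X -> 0 <= Y ->
  (forall a b, 0 <= Num.conj a * a * X - Num.conj a * b * Num.conj c
    - Num.conj b * a * c + Num.conj b * b * Y) ->
  `|c| ^+ 2 <= X * Y.
Proof.
move=> X0 Y0 E; rewrite normCK.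
have Xr := cj_ge0 X0; have Yr := cj_ge0 Y0.
case: (eqVneq Y 0) => [Y00|Y_neq0].
  rewrite Y00 in E *; rewrite mulr0.
  case: (eqVneq c 0) => [->|c0]; first by rewrite mul0r.
  have cc0 : c * Num.conj c != 0 by rewrite mul_conjC_eq0.
  have c0' : Num.conj c != 0 by rewrite conjC_eq0.
  (* For [Y = 0] the form is affine in [b]; this choice gives it the value X - 2 (X + 1) < 0. *)
  have := E 1 ((X + 1) / (c * Num.conj c) * c).
  have -> : Num.conj ((X + 1) / (c * Num.conj c) * c) =
      (X + 1) / (Num.conj c * c) * Num.conj c.
    rewrite !cjM; have -> : Num.conj (c * Num.conj c)^-1 = (Num.conj c * c)^-1.
      by rewrite [LHS]fmorphV [X in X^-1]cjM conjCK.
    by rewrite cjD conjC1 Xr.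
  rewrite conjC1.
  have -> : 1 * 1 * X - 1 * ((X + 1) / (c * Num.conj c) * c) * Num.conj c
     - (X + 1) / (Num.conj c * c) * Num.conj c * 1 * c
     + (X + 1) / (Num.conj c * c) * Num.conj c *
         ((X + 1) / (c * Num.conj c) * c) * 0 = - (X + 2).
    by field; rewrite c0 c0'.
  rewrite oppr_ge0 => le0.
  have : 0 < X + 2 by rewrite ltr_wpDl.
  by move=> /lt_le_trans /(_ le0); rewrite ltxx.
have Ygt0 : 0 < Y by rewrite lt_def Y_neq0.
have := E Y c; rewrite Yr.
have -> : Y * Y * X - Y * c * Num.conj c - Num.conj c * Y * c
   + Num.conj c * c * Y = Y * (X * Y - c * Num.conj c) by ring.
by rewrite pmulr_rge0 // subr_ge0.
Qed.

Lemma sum_CS (I : finType) (x y : I -> K) :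
  `|\sum_i x i * y i| ^+ 2 <= (\sum_i `|x i| ^+ 2) * (\sum_i `|y i| ^+ 2).
Proof.
apply: quad_CS; try by apply: sumr_ge0 => i _; rewrite exprn_ge0.
move=> a b; rewrite cj_sum !mulr_sumr -!sumrB -big_split /=.
apply: sumr_ge0 => i _.
have -> : Num.conj a * a * `|x i| ^+ 2 - Num.conj a * b * Num.conj (x i * y i) -
    Num.conj b * a * (x i * y i) + Num.conj b * b * `|y i| ^+ 2 =
    (a * x i - b * Num.conj (y i)) * Num.conj (a * x i - b * Num.conj (y i)).
  by rewrite cjD cjN !normCK !cjM !conjCK; ring.
by rewrite mul_conjC_ge0.
Qed.

End CauchySchwarz.

(** * C*-algebras and intertwiners *)

Section Star.
Variables (R : realType) (A : cstarAlgType R).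
Implicit Types x y : A.

Lemma starD x y : star (x + y) = star x + star y.
Proof. by have := star_semilinear 1 x y; rewrite rmorph1 !scale1r. Qed.

Lemma star0 : star (0 : A) = 0.
Proof. by apply: (@addrI _ (star (0 : A))); rewrite -starD !addr0. Qed.

Lemma starZ (a : R[i]) x : star (a *: x) = Num.conj a *: star x.
Proof. by have := star_semilinear a x 0; rewrite star0 !addr0. Qed.

Lemma star_sum I (r : seq I) (P : pred I) (F : I -> A) :
  star (\sum_(i <- r | P i) F i) = \sum_(i <- r | P i) star (F i).
Proof. exact: (big_morph _ starD star0). Qed.

Lemma star1 : star (1 : A) = 1.
Proof.
have : star (star (1 : A) * 1) = star 1 * 1 by rewrite starM starK.
by rewrite mulr1 starK => <-.
Qed.

End Star.

Section Matrices.
Variables (R : realType) (A : cstarAlgType R).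
Local Notation C := R[i].

Definition adjmx m n (v : 'M[A]_(m, n)) : 'M[A]_(n, m) :=
  (map_mx (@star R A) v)^T.

Definition ctrmx m n (X : 'M[C]_(m, n)) : 'M[C]_(n, m) :=
  (map_mx Num.conj X)^T.

Lemma adjmxE m n (v : 'M[A]_(m, n)) i j : adjmx v i j = star (v j i).
Proof. by rewrite !mxE. Qed.

Lemma ctrmxE m n (X : 'M[C]_(m, n)) i j : ctrmx X i j = Num.conj (X j i).
Proof. by rewrite !mxE. Qed.

Lemma inmxE m n (X : 'M[C]_(m, n)) i j : inmx A X i j = X i j *: 1.
Proof. by rewrite mxE. Qed.

Lemma ctrmxK m n (X : 'M[C]_(m, n)) : ctrmx (ctrmx X) = X.
Proof. by apply/matrixP=> i j; rewrite !ctrmxE conjCK. Qed.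

Lemma adjmxM m n p (v : 'M[A]_(m, n)) (w : 'M[A]_(n, p)) :
  adjmx (v *m w) = adjmx w *m adjmx v.
Proof.
apply/matrixP=> i j; rewrite adjmxE !mxE star_sum; apply: eq_bigr => k _.
by rewrite starM !adjmxE.
Qed.

Lemma ctrmxM m n p (X : 'M[C]_(m, n)) (Y : 'M[C]_(n, p)) :
  ctrmx (X *m Y) = ctrmx Y *m ctrmx X.
Proof. by rewrite /ctrmx map_mxM trmx_mul. Qed.

Lemma inmx_ctr m n (X : 'M[C]_(m, n)) : inmx A (ctrmx X) = adjmx (inmx A X).
Proof. by apply/matrixP=> i j; rewrite adjmxE !inmxE ctrmxE starZ star1. Qed.

Lemma inmxM m n p (X : 'M[C]_(m, n)) (Y : 'M[C]_(n, p)) :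
  inmx A (X *m Y) = inmx A X *m inmx A Y.
Proof. exact: map_mxM. Qed.

Lemma inmx1 n : inmx A (1%:M : 'M[C]_n) = 1%:M.
Proof. exact: map_mx1. Qed.

Lemma mulmx_in m n p (v : 'M[A]_(m, n)) (X : 'M[C]_(n, p)) i j :
  (v *m inmx A X) i j = \sum_k X k j *: v i k.
Proof.
by rewrite mxE; apply: eq_bigr => k _; rewrite inmxE -scalerAr mulr1.
Qed.

Lemma in_mulmx m n p (X : 'M[C]_(m, n)) (v : 'M[A]_(n, p)) i j :
  (inmx A X *m v) i j = \sum_k X i k *: v k j.
Proof.
by rewrite mxE; apply: eq_bigr => k _; rewrite inmxE -scalerAl mul1r.
Qed.

Lemma unitaryP n (v : 'M[A]_n) :
  unitary v <-> v *m adjmx v = 1%:M /\ adjmx v *m v = 1%:M.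
Proof. by []. Qed.

Lemma adj_intertwiner m n (v : 'M[A]_m) (w : 'M[A]_n) X :
  unitary v -> unitary w -> intertwiner v w X -> intertwiner w v (ctrmx X).
Proof.
move=> [vv' v'v] [ww' w'w] /(congr1 (@adjmx _ _)).
rewrite !adjmxM -!inmx_ctr => E; rewrite /intertwiner.
rewrite -[LHS]mulmx1 -v'v mulmxA -(mulmxA w) E.
by rewrite !mulmxA ww' mul1mx.
Qed.

Lemma comp_intertwiner m n p (v : 'M[A]_m) (w : 'M[A]_n) (x : 'M[A]_p) X Y :
  intertwiner v w X -> intertwiner w x Y -> intertwiner v x (X *m Y).
Proof.
rewrite /intertwiner => E1 E2.
by rewrite inmxM mulmxA E1 -mulmxA E2 mulmxA.
Qed.

Lemma conj_intertwiner m n (v : 'M[A]_m) (w : 'M[A]_n) X :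
  intertwiner v w X ->
  intertwiner (conjmx v) (conjmx w) (map_mx Num.conj X).
Proof.
rewrite /intertwiner => E; apply/matrixP=> i j.
have := congr1 (fun M : 'M[A]_(m, n) => star (M i j)) E.
rewrite /= mulmx_in in_mulmx !star_sum mulmx_in in_mulmx.
under eq_bigr do rewrite starZ; under [in RHS]eq_bigr do rewrite starZ.
under [in X in _ -> X]eq_bigr do rewrite !mxE.
by under [in X in _ -> _ = X]eq_bigr do rewrite !mxE.
Qed.

Lemma conjAK n (v : 'M[A]_n) : conjmx (conjmx v) = v.
Proof. by apply/matrixP=> i j; rewrite !mxE starK. Qed.

Lemma map_conjK m n (X : 'M[C]_(m, n)) :
  map_mx Num.conj (map_mx Num.conj X) = X.
Proof. by apply/matrixP=> i j; rewrite !mxE conjCK. Qed.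

Lemma ctrmx_mulE m n (X : 'M[C]_(m, n)) :
  \tr (ctrmx X *m X) = \sum_i \sum_j `|X i j| ^+ 2.
Proof.
rewrite exchange_big; apply: eq_bigr => j _; rewrite mxE.
by apply: eq_bigr => i _; rewrite ctrmxE normCK mulrC.
Qed.

Lemma ctrmx_mul_eq0 m n (X : 'M[C]_(m, n)) : \tr (ctrmx X *m X) = 0 -> X = 0.
Proof.
rewrite ctrmx_mulE => /eqP; rewrite psumr_eq0; last first.
  by move=> i _; apply: sumr_ge0 => j _; rewrite exprn_ge0.
move=> /allP Z; apply/matrixP=> i j; rewrite mxE.
have := Z i (mem_index_enum _); rewrite psumr_eq0; last first.
  by move=> k _; rewrite exprn_ge0.
move=> /allP /(_ j (mem_index_enum _)).
by rewrite /= expf_eq0 /= normr_eq0 => /eqP.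
Qed.

End Matrices.

Section State.
Variables (R : realType) (A : cstarAlgType R) (h : {scalar A}).
Local Notation C := R[i].
Hypothesis h_state : state h.
Implicit Types x y z : A.

Let h1 : h 1 = 1. Proof. by case: h_state. Qed.
Let h_ge0 x : 0 <= h (star x * x). Proof. by case: h_state => _. Qed.

Lemma stateD x y : h (x + y) = h x + h y.
Proof. exact: linearD. Qed.

Lemma stateB x y : h (x - y) = h x - h y.
Proof. exact: linearB. Qed.

Lemma state_sum I (r : seq I) (P : pred I) (F : I -> A) :
  h (\sum_(i <- r | P i) F i) = \sum_(i <- r | P i) h (F i).
Proof. exact: linear_sum. Qed.

Lemma stateZ (a : C) x : h (a *: x) = a * h x.
Proof. exact: linearZ. Qed.

(** Positivity makes [h (star (x + a%:A) * (x + a%:A))] real. The values [a = 1] and [a = 'i] give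
    two linear relations between [h x], [h (star x)] and their conjugates, which together are the
    claim. *)
Lemma state_star x : h (star x) = Num.conj (h x).
Proof.
have E (a : C) : h (star (x + a%:A) * (x + a%:A)) =
    h (star x * x) + a * h (star x) + Num.conj a * h x + Num.conj a * a.
  rewrite starD starZ star1 mulrDl !mulrDr -!scalerAl -!scalerAr mul1r !mulr1.
  by rewrite !stateD !stateZ h1 mulr1 addrA.
have := cj_ge0 (h_ge0 (x + (1 : C)%:A)).
have := cj_ge0 (h_ge0 (x + ('i : C)%:A)).
rewrite !E !cjD !cjM !conjCK conjCi (cj_ge0 (h_ge0 x)).
rewrite ?cjN ?conjCi ?opprK ?conjC1.
move: (h (star x * x)) (h (star x)) (h x) => n s t Ei E1.
have i0 : 'i != 0 :> C := neq0Ci _.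
have {}E1 : Num.conj s + Num.conj t = s + t.
  by apply: eq_by_sub E1; ring.
have {}Ei : 'i * (Num.conj t - Num.conj s) = 'i * (s - t).
  by apply: eq_by_sub Ei; ring.
have {}Ei := mulfI i0 Ei.
apply: (@mulfI _ 2); first by rewrite pnatr_eq0.
have E2 : s + t + (s - t) = s + t + (Num.conj t - Num.conj s) by rewrite Ei.
have E3 : s + t + (Num.conj t - Num.conj s) = 2 * Num.conj t.
  by rewrite -E1; ring.
by rewrite -E3 -E2; ring.
Qed.

Lemma state_CS x y :
  `|h (star y * x)| ^+ 2 <= h (star x * x) * h (star y * y).
Proof.
have E (a b : C) : h (star (a *: x - b *: y) * (a *: x - b *: y)) =
    Num.conj a * a * h (star x * x) - Num.conj a * b * h (star x * y)
    - Num.conj b * a * h (star y * x) + Num.conj b * b * h (star y * y).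
  have -> : star (a *: x - b *: y) = Num.conj a *: star x - Num.conj b *: star y.
    by rewrite -scaleNr starD !starZ cjN scaleNr.
  transitivity (h ((Num.conj a * a) *: (star x * x)
      - (Num.conj a * b) *: (star x * y)
      - ((Num.conj b * a) *: (star y * x) - (Num.conj b * b) *: (star y * y)))).
    by rewrite mulrBl !mulrBr -!scalerAl -!scalerAr !scalerA.
  by rewrite !stateB !stateZ; ring.
have Eyx : h (star x * y) = Num.conj (h (star y * x)).
  by rewrite -state_star starM starK.
apply: quad_CS => // a b; rewrite -Eyx -E; exact: h_ge0.
Qed.

End State.

Section Schur.
Variables (R : realType) (A : cstarAlgType R).
Local Notation C := R[i].

Lemma intertwinerZ m n (v : 'M[A]_m) (w : 'M[A]_n) X (c : C) :
  intertwiner v w X -> intertwiner v w (c *: X).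
Proof.
rewrite /intertwiner => E; apply/matrixP=> i j.
have := congr1 (fun M : 'M[A]_(m, n) => M i j) E.
rewrite !mulmx_in !in_mulmx => /(congr1 (fun x => c *: x)).
rewrite !scaler_sumr => {}E; under eq_bigr do rewrite mxE -scalerA.
by rewrite E; apply: eq_bigr => k _; rewrite mxE scalerA.
Qed.

Lemma adj_intertwiner_mul m n (v : 'M[A]_m) (w : 'M[A]_n) X :
  unitary v -> unitary w -> irreducible w -> intertwiner v w X -> X != 0 ->
  exists2 b, b != 0 & ctrmx X *m X = b%:M.
Proof.
move=> vu wu [n0 wi] XI X0.
have [b Eb] := wi _ (comp_intertwiner (adj_intertwiner vu wu XI) XI).
exists b => //; apply: contraNneq X0 => b0; apply/eqP/ctrmx_mul_eq0.
by rewrite Eb b0 mxtrace_scalar mul0rn.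
Qed.

(** If [X] is nonzero, both products of [X] with its adjoint are scalar, with the same nonzero
    scalar, so [X] is invertible and the representations are equivalent. *)
Lemma schur_neq m n (v : 'M[A]_m) (w : 'M[A]_n) X :
  unitary v -> unitary w -> irreducible v -> irreducible w ->
  ~ equivalent v w -> intertwiner v w X -> X = 0.
Proof.
move=> vu wu vi wi neq XI; apply/eqP; apply: contraPT neq => X0.
have XJ := adj_intertwiner vu wu XI.
have [a Ea] := vi.2 _ (comp_intertwiner XI XJ).
have [b b0 Eb] := adj_intertwiner_mul vu wu wi XI X0.
have ab : a = b.
  have : (a - b) *: X = 0.
    by rewrite scalerBl -!mul_scalar_mx -Ea -scalar_mxC -Eb mulmxA subrr.
  by move=> /eqP; rewrite scaler_eq0 (negPf X0) orbF subr_eq0 => /eqP.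
apply; exists X, (b^-1 *: ctrmx X); split=> //.
  by rewrite -scalemxAr Ea ab scale_scalar_mx mulVf.
by rewrite -scalemxAl Eb scale_scalar_mx mulVf.
Qed.

Lemma ctr_conj m n (X : 'M[C]_(m, n)) :
  ctrmx (map_mx Num.conj X) = map_mx Num.conj (ctrmx X).
Proof. by apply/matrixP=> i j; rewrite !mxE. Qed.

(* [w] is a subrepresentation of [v] through the intertwiner [X], an isometry up
   to a scalar by Schur's lemma; so [conjmx w] is one of [conjmx v]. *)
Lemma conj_unitary_sub m n (v : 'M[A]_m) (w : 'M[A]_n) X :
  unitary v -> unitary (conjmx v) -> unitary w -> irreducible w ->
  intertwiner v w X -> X != 0 -> unitary (conjmx w).
Proof.
move=> vu [cvr cvl] wu wi XI X0.
have [b b0 Eb] := adj_intertwiner_mul vu wu wi XI X0.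
pose Z := map_mx Num.conj X; pose Y := (Num.conj b)^-1 *: ctrmx Z.
have b0' : Num.conj b != 0 by rewrite conjC_eq0.
have YZ : Y *m Z = 1%:M.
  rewrite /Y -scalemxAl ctr_conj -map_mxM Eb map_scalar_mx.
  by rewrite scale_scalar_mx mulVf.
have YZA : inmx A Y *m inmx A Z = 1%:M by rewrite -inmxM YZ inmx1.
have ZI := conj_intertwiner XI.
have YI : intertwiner (conjmx w) (conjmx v) Y.
  apply: intertwinerZ; rewrite ctr_conj; apply: conj_intertwiner.
  exact: adj_intertwiner.
(* Since [Y] is a multiple of the adjoint of [Z], both also intertwine the adjoints of the
   conjugates. Each unitarity relation of [conjmx w] then reduces to that of [conjmx v] between [Y]
   and [Z]. *)
have E1 : inmx A Z *m adjmx (conjmx w) = adjmx (conjmx v) *m inmx A Z.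
  have := intertwinerZ (Num.conj b) YI.
  rewrite /Y scalerA divff // scale1r /intertwiner => /(congr1 (@adjmx _ _ _ _)).
  by rewrite !adjmxM -!inmx_ctr ctrmxK.
have E2 : adjmx (conjmx w) *m inmx A Y = inmx A Y *m adjmx (conjmx v).
  have : adjmx (conjmx w) *m inmx A (ctrmx Z) =
      inmx A (ctrmx Z) *m adjmx (conjmx v).
    by rewrite inmx_ctr -!adjmxM ZI.
  move=> E; have : intertwiner (adjmx (conjmx w)) (adjmx (conjmx v)) (ctrmx Z) by [].
  by move=> /(intertwinerZ (Num.conj b)^-1).
split; change (map_mx (@star R A) (conjmx w))^T with (adjmx (conjmx w)).
  rewrite -[X in X *m _]mulmx1 -YZA mulmxA -mulmxA E1 YI !mulmxA.
  by rewrite -(mulmxA (inmx A Y)) cvr mulmx1.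
rewrite -[X in X *m _]mulmx1 -YZA mulmxA -mulmxA E2 -ZI !mulmxA.
by rewrite -(mulmxA (inmx A Y)) cvl mulmx1.
Qed.

End Schur.

(** * Block decompositions and tensor products *)

Section Blocks.
Variables (R : realType) (A : cstarAlgType R).
Local Notation C := R[i].

(** The block columns of an equivalence are the inclusions of the constituents, and the block rows
    of its inverse are the matching projections. *)
Lemma equivalent_blocks p (p_ : 'I_p -> nat) m (w : 'M[A]_m)
    (v : forall i, 'M[A]_(p_ i)) :
  equivalent w (\mxdiag_i v i) ->
  exists (X : forall i, 'M[C]_(m, p_ i)) (Y : forall i, 'M[C]_(p_ i, m)),
    [/\ forall i, intertwiner w (v i) (X i), forall i, Y i *m X i = 1%:M &
      \sum_i X i *m Y i = 1%:M].
Proof.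
move=> [X [Y [XY YX XI]]]; exists (submxrow X), (submxcol Y); split.
- move=> i; rewrite /intertwiner.
  have map_sub (Z : 'M[C]_(m, \sum_i p_ i)) :
      inmx A (submxrow Z i) = submxrow (inmx A Z) i.
    by apply/matrixP=> j k; rewrite !mxE.
  rewrite map_sub mul_submxrow XI.
  by rewrite -{1}[inmx A X]submxrowK mul_mxrow_mxdiag mxrowK.
- move=> i; rewrite mul_submxrow submxcol_mul YX.
  rewrite -[1%:M]mxdiagZ.
  by rewrite -submxblockEv submxblock_diag.
by rewrite -mul_mxrow_mxcol submxrowK submxcolK.
Qed.

End Blocks.

Section Tensor.
Variables (R : realType) (A : cstarAlgType R).

Lemma sum_tens_index m n (V : nmodType) (F : 'I_(m * n) -> V) :
  \sum_k F k = \sum_i \sum_j F (mxtens_index (i, j)).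
Proof.
rewrite pair_big /= (reindex (@mxtens_index m n)) /=.
  by apply: eq_bigr => -[i j] _.
by exists (@mxtens_unindex m n) => k _; rewrite ?mxtens_indexK ?mxtens_unindexK.
Qed.

Lemma unitaryE n (v : 'M[A]_n) :
  (forall i j, \sum_k v i k * star (v j k) = (i == j)%:R) ->
  (forall i j, \sum_k star (v k i) * v k j = (i == j)%:R) -> unitary v.
Proof.
move=> E1 E2; split; apply/matrixP=> i j; rewrite !mxE.
  by rewrite -E1; apply: eq_bigr => k _; rewrite !mxE.
by rewrite -E2; apply: eq_bigr => k _; rewrite !mxE.
Qed.

Lemma unitary_row n (v : 'M[A]_n) i j : unitary v ->
  \sum_k v i k * star (v j k) = (i == j)%:R.
Proof.
case=> /matrixP/(_ i j) + _; rewrite !mxE => <-.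
by apply: eq_bigr => k _; rewrite !mxE.
Qed.

Lemma unitary_col n (v : 'M[A]_n) i j : unitary v ->
  \sum_k star (v k i) * v k j = (i == j)%:R.
Proof.
case=> _ /matrixP/(_ i j) +; rewrite !mxE => <-.
by apply: eq_bigr => k _; rewrite !mxE.
Qed.

Lemma tens_index_eq m n i i' j j' :
  (@mxtens_index m n (i, i') == mxtens_index (j, j')) = (i == j) && (i' == j').
Proof. by rewrite (can_eq (@mxtens_indexK m n)) xpair_eqE. Qed.

Lemma tens_unitary m n (v : 'M[A]_m) (w : 'M[A]_n) :
  unitary v -> unitary w -> unitary (v *t w).
Proof.
move=> vu wu; apply: unitaryE => p q;
  case: p / mxtens_indexP => i i'; case: q / mxtens_indexP => j j';
  rewrite sum_tens_index tens_index_eq -mulnb natrM.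
  under eq_bigr => k _ do under eq_bigr => k' _ do
    rewrite !tensmxE starM -mulrA (mulrA (w _ _)).
  under eq_bigr do rewrite -mulr_sumr -mulr_suml unitary_row // mulr_natl mulrnAr.
  by rewrite sumrMnl unitary_row // mulr_natr.
rewrite exchange_big.
under eq_bigr => k _ do under eq_bigr => k' _ do
  rewrite !tensmxE starM -mulrA (mulrA (star (v _ _))).
under eq_bigr do rewrite -mulr_sumr -mulr_suml unitary_col // mulr_natl mulrnAr.
by rewrite sumrMnl unitary_col // mulr_natl.
Qed.

(* [star] reverses products, so [conjmx (v *t w)] is the tensor product of the
   conjugates in the opposite order. *)
Lemma tens_conj_unitary m n (v : 'M[A]_m) (w : 'M[A]_n) :
  unitary (conjmx v) -> unitary (conjmx w) -> unitary (conjmx (v *t w)).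
Proof.
have conjE k (x : 'M[A]_k) i j : conjmx x i j = star (x i j) by rewrite mxE.
move=> vu wu; apply: unitaryE => p q;
  case: p / mxtens_indexP => i i'; case: q / mxtens_indexP => j j';
  rewrite sum_tens_index tens_index_eq -mulnb natrM.
  rewrite exchange_big.
  under eq_bigr => k _ do under eq_bigr => k' _ do
    rewrite !conjE !tensmxE !starM !starK -mulrA (mulrA (star (v _ _))).
  under eq_bigr => k _.
    rewrite -mulr_sumr -mulr_suml.
    have -> : \sum_i0 star (v i i0) * v j i0 = (i == j)%:R.
      by rewrite -(unitary_row i j vu); apply: eq_bigr => l _; rewrite !conjE starK.
    rewrite mulr_natl mulrnAr.
    over.
  rewrite sumrMnl mulr_natl -(unitary_row i' j' wu); congr (_ *+ _).
  by apply: eq_bigr => k _; rewrite !conjE starK.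
under eq_bigr => k _ do under eq_bigr => k' _ do
  rewrite !conjE !tensmxE !starM !starK -mulrA (mulrA (w _ _)).
under eq_bigr => k _.
  rewrite -mulr_sumr -mulr_suml.
  have -> : \sum_i0 w i0 i' * star (w i0 j') = (i' == j')%:R.
    by rewrite -(unitary_col i' j' wu); apply: eq_bigr => l _; rewrite !conjE starK.
  rewrite mulr_natl mulrnAr.
  over.
rewrite sumrMnl mulr_natr -(unitary_col i j vu); congr (_ *+ _).
by apply: eq_bigr => k _; rewrite !conjE starK.
Qed.

End Tensor.

(** * The Frobenius norm and real parts *)

Section Frobenius.
Variable R : realType.
Local Notation C := R[i].

Definition fro m n (M : 'M[C]_(m, n)) : C := \sum_i \sum_j `|M i j| ^+ 2.

Lemma fro_ge0 m n (M : 'M[C]_(m, n)) : 0 <= fro M.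
Proof. by apply: sumr_ge0 => i _; apply: sumr_ge0 => j _; rewrite exprn_ge0. Qed.

Lemma ctrmxB m n (M N : 'M[C]_(m, n)) : ctrmx (M - N) = ctrmx M - ctrmx N.
Proof. by apply/matrixP => i j; rewrite !mxE cjD cjN. Qed.

Lemma ctrmxZ m n a (M : 'M[C]_(m, n)) : ctrmx (a *: M) = Num.conj a *: ctrmx M.
Proof. by apply/matrixP => i j; rewrite !mxE cjM. Qed.

Lemma fro_tr m n (M : 'M[C]_(m, n)) : fro M = \tr (ctrmx M *m M).
Proof. by rewrite ctrmx_mulE. Qed.

Lemma fro_trmx m n (M : 'M[C]_(m, n)) : fro M^T = fro M.
Proof.
rewrite /fro exchange_big; apply: eq_bigr => i _; apply: eq_bigr => j _.
by rewrite mxE.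
Qed.

Lemma fro_tens m n p q (M : 'M[C]_(m, n)) (N : 'M[C]_(p, q)) :
  fro (M *t N) = fro M * fro N.
Proof.
rewrite /fro sum_tens_index.
under eq_bigr => i _ do under eq_bigr => i' _ do rewrite sum_tens_index.
rewrite mulr_suml; apply: eq_bigr => i _; rewrite mulr_sumr; apply: eq_bigr => i' _.
rewrite mulr_suml; apply: eq_bigr => j _; rewrite mulr_sumr; apply: eq_bigr => j' _.
by rewrite tensmxE normrM exprMn.
Qed.

(** The hypothesis makes the adjoint of [B] times [B], divided by [l], a projection. The bound is
    the nonnegativity of the norm of its complement applied to [M]. *)
Lemma fro_mul_le m n p (B : 'M[C]_(m, n)) (M : 'M[C]_(n, p)) (l : C) :
  0 < l -> B *m ctrmx B = l%:M -> fro (B *m M) <= l * fro M.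
Proof.
move=> l0 BB; have := fro_ge0 (l *: M - ctrmx B *m (B *m M)).
have -> : fro (l *: M - ctrmx B *m (B *m M)) = l * (l * fro M - fro (B *m M)).
  rewrite !fro_tr ctrmxB ctrmxZ (cj_ge0 (ltW l0)) !ctrmxM ctrmxK.
  rewrite mulmxBl !mulmxBr -!scalemxAl -!scalemxAr !mulmxA.
  rewrite -(mulmxA _ B (ctrmx B)) BB mul_mx_scalar -!scalemxAl.
  by rewrite subrr subr0 linearB /= !mxtraceZ mulrBr.
by rewrite pmulr_rge0 // subr_ge0.
Qed.

End Frobenius.

Section RealPart.
Variable R : realType.
Implicit Types x y : R[i].
Local Notation Re := complex.Re.

Lemma ReD x y : Re (x + y) = Re x + Re y.
Proof. by case: x y => [a b] [c d]. Qed.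

Lemma Re_sum I (r : seq I) (P : pred I) (F : I -> R[i]) :
  Re (\sum_(i <- r | P i) F i) = \sum_(i <- r | P i) Re (F i).
Proof. exact: (big_morph _ ReD). Qed.

Lemma complexRe_conj x : Re (Num.conj x) = Re x.
Proof. by case: x. Qed.

Lemma Re_ge0 x : 0 <= x -> x = (Re x)%:C.
Proof. by move=> x0; rewrite RRe_real // ger0_real. Qed.

Lemma Re_sqr_le x : (Re x ^+ 2)%:C <= `|x| ^+ 2.
Proof. by rewrite -add_Re2_Im2 lecR lerDl sqr_ge0. Qed.

End RealPart.

(* The constituents of [u^i (x) u^j] are the [u^(fusion_index i j l)] with
   [l <= minn i j]. *)
Definition fusion_index i j l := ((i - j) + (j - i) + l.*2)%N.

Lemma fusion_index_inj i j : injective (fusion_index i j).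
Proof. by move=> l m /addnI /double_inj. Qed.

Lemma fusion_index_le i j l : (l <= minn i j)%N -> (fusion_index i j l <= i + j)%N.
Proof. by rewrite /fusion_index; lia. Qed.

Lemma fusion_index_odd i j l : odd (fusion_index i j l) = odd (i + j).
Proof. by rewrite /fusion_index; lia. Qed.

(** * The inequality for arrays *)

Section Estimates.
Variable R : realFieldType.
Implicit Types a b c g p q r s t x y z : R.

Lemma quad_form_le a b c x y : 0 < a -> c ^+ 2 <= 4 * a * b ->
  c * x * y <= a * x ^+ 2 + b * y ^+ 2.
Proof.
move=> a0 cab; rewrite -subr_ge0 -(pmulr_rge0 _ a0).
have -> : a * (a * x ^+ 2 + b * y ^+ 2 - c * x * y) =
    (a * x - c / 2 * y) ^+ 2 + (4 * a * b - c ^+ 2) / 4 * y ^+ 2 by field.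
apply: addr_ge0; first exact: sqr_ge0.
by rewrite mulr_ge0 ?sqr_ge0 // divr_ge0 ?subr_ge0.
Qed.

(** Cauchy-Schwarz: the condition on [p] and [q] puts them in the dual unit ball of the quadratic
    form. This yields linear minorants of a square root. *)
Lemma tangent_le a b x y p q r : 0 < a -> 0 < b -> 0 <= r ->
  p ^+ 2 / a + q ^+ 2 / b <= 1 -> a * x ^+ 2 + b * y ^+ 2 <= r ^+ 2 ->
  p * x + q * y <= r.
Proof.
move=> a0 b0 r0 pq rE; apply: le_trans (ler_norm _) _.
rewrite -(ler_pXn2r (ltn0Sn 1)) ?nnegrE // real_normK ?num_real //.
apply: le_trans rE.
have -> : (p * x + q * y) ^+ 2 = (p ^+ 2 / a + q ^+ 2 / b)
    * (a * x ^+ 2 + b * y ^+ 2) - (a * q * x - b * p * y) ^+ 2 / (a * b).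
  by field; rewrite !gt_eqF.
rewrite lerBlDr; apply: ler_wpDr.
  by rewrite divr_ge0 ?sqr_ge0 // ltW // mulr_gt0.
rewrite -[leRHS]mul1r; apply: ler_wpM2r => //.
by apply: addr_ge0; rewrite mulr_ge0 ?sqr_ge0 // ltW.
Qed.

(** Only one factor of [r ^+ 3] needs a minorant, as [r ^+ 2] is already a polynomial. *)
Lemma cube_tangent F r t : 0 <= F -> 0 <= r -> t <= r ->
  F * r ^+ 2 * t <= F * r ^+ 3.
Proof.
move=> F0 r0 tr; have -> : F * r ^+ 3 = F * r ^+ 2 * r by ring.
by apply: ler_wpM2l => //; rewrite mulr_ge0 ?sqr_ge0.
Qed.

(* In the next three lemmas the norm [r] is replaced by its tangent at the
   point where the inequality is tightest. *)
Lemma cubic4 x s r : 0 <= x -> 0 <= s -> 0 <= r -> r ^+ 2 = 7 * x ^+ 2 + s ^+ 2 ->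
  2237 / 1000 * x ^+ 3 + 1766 / 1000 * x ^+ 2 * s + 45 / 32 * x * s ^+ 2
    + 46 / 100 * s ^+ 3 <= 58 / 100 * r ^+ 3.
Proof.
move=> x0 s0 r0 rE.
have T : 1046 / 1000 * x + 918 / 1000 * s <= r.
  by apply: (@tangent_le 7 1) => //; [lra|rewrite rE mul1r lexx].
apply: le_trans (cube_tangent _ r0 T); last by lra.
rewrite rE.
(* The inequality is tightest near x = 0.165 s, which is also about where the tangent touches; [H1]
   and [H2] account for this near double root. *)
have H1 : 0 <= x * (x - 165 / 1000 * s) ^+ 2 by rewrite mulr_ge0 ?sqr_ge0.
have H2 : 0 <= s * (x - 165 / 1000 * s) ^+ 2 by rewrite mulr_ge0 ?sqr_ge0.
have H3 : 0 <= x * x * s by rewrite !mulr_ge0.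
have H4 : 0 <= x * s * s by rewrite !mulr_ge0.
have H5 : 0 <= x * x * x by rewrite !mulr_ge0.
have H6 : 0 <= s * s * s by rewrite !mulr_ge0.
lra.
Qed.

Lemma cubic3 z s r : 0 <= z -> 0 <= s -> 0 <= r -> r ^+ 2 = 4 * z ^+ 2 + s ^+ 2 ->
  2343 / 1000 * z ^+ 2 * s + 1389 / 1000 * z * s ^+ 2 + 58 / 100 * s ^+ 3
   <= 772 / 1000 * r ^+ 3.
Proof.
move=> z0 s0 r0 rE.
have T : 885 / 1000 * z + 896 / 1000 * s <= r.
  by apply: (@tangent_le 4 1) => //; [lra|rewrite rE mul1r lexx].
apply: le_trans (cube_tangent _ r0 T); last by lra.
rewrite rE.
have H1 : 0 <= z * (z - 25 / 100 * s) ^+ 2 by rewrite mulr_ge0 ?sqr_ge0.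
have H2 : 0 <= s * (z - 25 / 100 * s) ^+ 2 by rewrite mulr_ge0 ?sqr_ge0.
have H3 : 0 <= z * z * s by rewrite !mulr_ge0.
have H4 : 0 <= z * s * s by rewrite !mulr_ge0.
have H5 : 0 <= z * z * z by rewrite !mulr_ge0.
have H6 : 0 <= s * s * s by rewrite !mulr_ge0.
lra.
Qed.

Lemma cubic2 y s r : 0 <= y -> 0 <= s -> 0 <= r ->
  r ^+ 2 = 5 / 3 * y ^+ 2 + s ^+ 2 ->
  24 / 10 * y ^+ 3 + 177 / 100 * y * s ^+ 2 + 772 / 1000 * s ^+ 3
   <= r ^+ 3 + 16 / 10 * y ^+ 2 * r.
Proof.
move=> y0 s0 r0 rE.
have H3 : 0 <= y * y * s by rewrite !mulr_ge0.
have H4 : 0 <= y * s * s by rewrite !mulr_ge0.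
have H5 : 0 <= y * y * y by rewrite !mulr_ge0.
have H6 : 0 <= s * s * s by rewrite !mulr_ge0.
have TT t : t <= r -> r ^+ 2 * t + 16 / 10 * y ^+ 2 * t <=
    r ^+ 3 + 16 / 10 * y ^+ 2 * r.
  move=> tr; apply: lerD.
    by have := cube_tangent ler01 r0 tr; rewrite !mul1r.
  by apply: ler_wpM2l => //; rewrite mulr_ge0 ?sqr_ge0 //; lra.
(* The tight point is near y = 0.24 s, but the tangent chosen for it yields only 0.467 (5/3 + 16/10)
   < 24/10 as coefficient of y^3. For large [y] a steeper one is used. *)
have [ys|sy] := lerP y (5 / 2 * s).
  have T : 467 / 1000 * y + 932 / 1000 * s <= r.
    by apply: (@tangent_le (5 / 3) 1) => //; [lra|lra|rewrite rE mul1r lexx].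
  apply: le_trans (TT _ T); rewrite rE.
  have H1 : 0 <= (5 / 2 * s - y) * (y - 24 / 100 * s) ^+ 2.
    by rewrite mulr_ge0 ?sqr_ge0 ?subr_ge0.
  have H2 : 0 <= s * (y - 24 / 100 * s) ^+ 2 by rewrite mulr_ge0 ?sqr_ge0.
  lra.
have T : 106 / 100 * y + 564 / 1000 * s <= r.
  by apply: (@tangent_le (5 / 3) 1) => //; [lra|lra|rewrite rE mul1r lexx].
apply: le_trans (TT _ T); rewrite rE.
have H7 : 0 <= (y - 5 / 2 * s) * (y * y) by rewrite mulr_ge0 ?subr_ge0 ?mulr_ge0 // ltW.
have H8 : 0 <= (y - 5 / 2 * s) * (y * s) by rewrite mulr_ge0 ?subr_ge0 ?mulr_ge0 // ltW.
have H9 : 0 <= (y - 5 / 2 * s) * (s * s) by rewrite mulr_ge0 ?subr_ge0 ?mulr_ge0 // ltW.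
lra.
Qed.

(* The slack of [r^2 >= 7 x^2] is spent on the mixed term [y^2 x]. *)
Lemma quadratic2 y z x a5 a6 g s r : 0 <= y ->
  a5 ^+ 2 + a6 ^+ 2 <= g ^+ 2 ->
  32 / 3 * g ^+ 2 + 13 / 3 * a6 ^+ 2 <= s ^+ 2 ->
  r ^+ 2 = 4 * z ^+ 2 + (7 * x ^+ 2 + s ^+ 2) ->
  y * (5199 / 1000 * z ^+ 2 + 849 / 100 * z * a5 + 5199 / 1000 * x ^+ 2
       + 8784 / 1000 * x * a6 + 9 * g ^+ 2) + 4026 / 1000 * y ^+ 2 * x
    <= 177 / 100 * y * r ^+ 2 + 667 / 1000 * y ^+ 3.
Proof.
move=> y0 ag gs rE; have := sqr_ge0 z; have := sqr_ge0 x; have := sqr_ge0 a6 => *.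
(* The three splittings are balanced so that, with the diagonal terms, they nearly exhaust the
   coefficients of z^2, x^2, g^2 and a6^2 available in 177/100 r^2. *)
have E1 : 849 / 100 * z * a5 <= 188 / 100 * z ^+ 2 + 988 / 100 * a5 ^+ 2.
  by apply: quad_form_le; clear; lra.
have E2 : 8784 / 1000 * x * a6 <= 11 / 10 * x ^+ 2 + 1754 / 100 * a6 ^+ 2.
  by apply: quad_form_le; clear; lra.
have E3 : 4026 / 1000 * y * x <= 667 / 1000 * y ^+ 2 + 6086 / 1000 * x ^+ 2.
  by apply: quad_form_le; clear; lra.
have -> : 177 / 100 * y * r ^+ 2 + 667 / 1000 * y ^+ 3 =
  y * (177 / 100 * r ^+ 2 + 667 / 1000 * y ^+ 2) by ring.
have -> : 4026 / 1000 * y ^+ 2 * x = y * (4026 / 1000 * y * x) by ring.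
rewrite -mulrDr; apply: ler_wpM2l => //; rewrite rE; clear y0 rE; lra.
Qed.

(* After multiplication by [q], [q (q - c y) >= (q^2 - c^2 y^2) / 2] with
   [c = 1.155 > sqrt (4/3)] turns this into quadratic forms in [(y, z)], [(z, x)]
   and [(x, a5)], with coefficients in [p] and [q]. *)
Lemma quadratic1 p q y z x a5 g s : 0 <= p -> 0 <= q -> 0 <= y -> 0 <= z -> 0 <= x ->
  0 <= a5 -> a5 ^+ 2 <= g ^+ 2 -> 32 / 3 * g ^+ 2 <= s ^+ 2 ->
  q ^+ 2 = 5 / 3 * y ^+ 2 + (4 * z ^+ 2 + (7 * x ^+ 2 + s ^+ 2)) ->
  3465 / 1000 * p ^+ 2 * y + 735 / 100 * p * y * z + 759 / 100 * p * z * x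
    + 7746 / 1000 * p * x * a5 + 6 * p * g ^+ 2
  <= 3 * p ^+ 2 * q
     + q * (14 / 10 * y ^+ 2 + 3 * (z ^+ 2 + x ^+ 2 + g ^+ 2)).
Proof.
move=> p0 q0 y0 z0 x0 a0 ag gs qE.
have [q00|q_neq0] := eqVneq q 0.
  have sq (w : R) : 0 <= w ^+ 2 by exact: sqr_ge0.
  have Z (w : R) : w ^+ 2 <= 0 -> w = 0.
    by move=> w0; apply/eqP; rewrite -sqrf_eq0 eq_le w0 sq.
  have := sq y; have := sq z; have := sq x; have := sq s; have := sq g.
  have := sq a5; rewrite q00 expr0n /= in qE => *.
  have -> : y = 0 by apply: Z; lra.
  have -> : z = 0 by apply: Z; lra.
  have -> : x = 0 by apply: Z; lra.
  have -> : g = 0 by apply: Z; lra.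
  by rewrite q00; lra.
have q_gt0 : 0 < q by rewrite lt_def q_neq0.
rewrite -(ler_pM2l q_gt0) -subr_ge0.
have pp0 := sqr_ge0 p; have qq0 := sqr_ge0 q.
have qq_gt0 : 0 < q ^+ 2 by rewrite exprn_gt0.
have pq0 : 0 <= p ^+ 2 * q ^+ 2 by exact: mulr_ge0.
(* The coefficients of p^2 are 3/2 times the weights in [qE], lowered by (3/2) 1.155^2 for [y];
   those of q^2 come from the right-hand side. The forms in z^2 and x^2 are each shared by two mixed
   terms, in the proportions 0.805 : 0.195 and 0.77 : 0.23. *)
have Hyz : 735 / 100 * (p * q) * y * z <=
    (4989 / 1000 * p ^+ 2 + 14 * q ^+ 2) / 10 * y ^+ 2
    + 805 / 1000 * (6 * p ^+ 2 + 3 * q ^+ 2) * z ^+ 2.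
  (* The discriminant condition is a quartic form in [p] and [q], close to a multiple of this
     square. *)
  have P1 : 0 <= (p ^+ 2 - 1184 / 1000 * q ^+ 2) ^+ 2 by exact: sqr_ge0.
  have q4 : 0 <= (q ^+ 2) ^+ 2 by exact: sqr_ge0.
  have p4 : 0 <= (p ^+ 2) ^+ 2 by exact: sqr_ge0.
  by clear -pp0 qq_gt0 pq0 P1 q4 p4; apply: quad_form_le; lra.
have Hzx : 759 / 100 * (p * q) * z * x <=
    195 / 1000 * (6 * p ^+ 2 + 3 * q ^+ 2) * z ^+ 2
    + 77 / 100 * (21 / 2 * p ^+ 2 + 3 * q ^+ 2) * x ^+ 2.
  have P1 : 0 <= (p ^+ 2 - 378 / 1000 * q ^+ 2) ^+ 2 by exact: sqr_ge0.
  have q4 : 0 <= (q ^+ 2) ^+ 2 by exact: sqr_ge0.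
  have p4 : 0 <= (p ^+ 2) ^+ 2 by exact: sqr_ge0.
  by clear -pp0 qq_gt0 pq0 P1 q4 p4; apply: quad_form_le; lra.
have Hxa : 7746 / 1000 * (p * q) * x * a5 <=
    23 / 100 * (21 / 2 * p ^+ 2 + 3 * q ^+ 2) * x ^+ 2
    + (16 * p ^+ 2 - 6 * p * q + 3 * q ^+ 2) * a5 ^+ 2.
  have P1 : 0 <= (p ^+ 2 - 3 / 16 * p * q - q ^+ 2 / 20) ^+ 2 by exact: sqr_ge0.
  have P2 : 0 <= (p * q - 43 / 100 * q ^+ 2) ^+ 2 by exact: sqr_ge0.
  have P3 : 0 <= p * q * q ^+ 2 by rewrite !mulr_ge0 // ltW.
  have q4 : 0 <= (q ^+ 2) ^+ 2 by exact: sqr_ge0.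
  by clear -pp0 qq_gt0 pq0 P1 P2 P3 q4; apply: quad_form_le; lra.
have Ha : 0 <= (16 * p ^+ 2 - 6 * p * q + 3 * q ^+ 2) * (g ^+ 2 - a5 ^+ 2).
  apply: mulr_ge0; last by rewrite subr_ge0.
  by have := sqr_ge0 (3 * p - q); clear -pp0 qq_gt0; lra.
have Hs : 0 <= p ^+ 2 * (s ^+ 2 - 32 / 3 * g ^+ 2).
  by apply: mulr_ge0 => //; rewrite subr_ge0.
have Hq : p ^+ 2 * q ^+ 2 =
    p ^+ 2 * (5 / 3 * y ^+ 2 + (4 * z ^+ 2 + (7 * x ^+ 2 + s ^+ 2))) by rewrite -qE.
have Hy : 0 <= p ^+ 2 * (q - 1155 / 1000 * y) ^+ 2.
  by rewrite mulr_ge0 ?sqr_ge0.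
have Hpy : 0 <= p ^+ 2 * y ^+ 2 by rewrite mulr_ge0 ?sqr_ge0.
clear -Hyz Hzx Hxa Ha Hs Hq Hy Hpy; lra.
Qed.

End Estimates.

Section Tail.
Variable R : realFieldType.

(* A telescoping majorant of the sum of [k.+1 ^ 2 / gap k ^ 3] over [k >= m]. *)
Definition tail_weight (m : nat) : R :=
  9 / ((m%:R + 1 / 2) * ((m%:R + 1 / 2) ^+ 2 - 7)).

(* The eigenvalue of [L - I] on [V_k]. *)
Definition gap (k : nat) : R := (k%:R - 1) * (k%:R + 3) / 3.

(** The shift by 1/2 makes the two weights symmetric about x + 1, so that everything is a function
    of D = (x + 1)^2. Both sides behave like 27 / D^2; the 7 in [tail_weight] decides the next order
    in favour of the claim. *)
Lemma tail_weight_step m : (5 <= m)%N ->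
  m.+1%:R ^+ 2 / gap m ^+ 3 + tail_weight m.+1 <= tail_weight m.
Proof.
move=> m5; rewrite /gap /tail_weight -natr1; have : (5 : R) <= m%:R by rewrite ler_nat.
move: (m%:R : R) => x x5.
have D36 : 36 <= (x + 1) ^+ 2.
  have -> : (x + 1) ^+ 2 = 36 + (x - 5) * (x + 7) by ring.
  by rewrite lerDl mulr_ge0 //; lra.
set D := (x + 1) ^+ 2 in D36 *.
have w1 : 0 < (x + 1 / 2) ^+ 2 - 7.
  have -> : (x + 1 / 2) ^+ 2 - 7 = (x - 5) * (x + 6) + 93 / 4 by field.
  by apply: ltr_wpDl; [rewrite mulr_ge0 //; lra|lra].
have w2 : 0 < (x + 1 + 1 / 2) ^+ 2 - 7.
  have -> : (x + 1 + 1 / 2) ^+ 2 - 7 = (x - 5) * (x + 8) + 141 / 4 by field.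
  by apply: ltr_wpDl; [rewrite mulr_ge0 //; lra|lra].
have wx : 0 < (x + 1 / 2) * (x + 1 + 1 / 2) by apply: mulr_gt0; lra.
have P_gt0 : 0 < (D - 1 / 4) * ((D - 27 / 4) ^+ 2 - D).
  have -> : (D - 1 / 4) * ((D - 27 / 4) ^+ 2 - D) =
     (x + 1 / 2) * (x + 1 + 1 / 2) *
     (((x + 1 / 2) ^+ 2 - 7) * ((x + 1 + 1 / 2) ^+ 2 - 7)) by rewrite /D; field.
  by apply: mulr_gt0 => //; apply: mulr_gt0.
have D4 : 0 < (D - 4) ^+ 3 by rewrite exprn_gt0 //; lra.
rewrite -lerBrDr.
have -> : 9 / ((x + 1 / 2) * ((x + 1 / 2) ^+ 2 - 7)) -
   9 / ((x + 1 + 1 / 2) * ((x + 1 + 1 / 2) ^+ 2 - 7)) =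
   9 * (3 * D - 27 / 4) / ((D - 1 / 4) * ((D - 27 / 4) ^+ 2 - D)).
  have D1 : 0 < D - 1 / 4 by lra.
  have := P_gt0; rewrite pmulr_rgt0 // => P2.
  rewrite /D; field; rewrite -/D.
  by apply/and5P; split; [..|apply/andP; split]; apply: lt0r_neq0; lra.
have -> : ((x - 1) * (x + 3) / 3) ^+ 3 = (D - 4) ^+ 3 / 27 by rewrite /D; field.
rewrite ler_pdivlMr // mulrC mulrA ler_pdivrMr ?divr_gt0 //.
have D2 : 0 <= (D - 36) * D by rewrite mulr_ge0 //; lra.
have D3 : 0 <= (D - 36) * (D * D) by rewrite !mulr_ge0 //; lra.
lra.
Qed.

(** Cauchy-Schwarz for the vectors (d / sqrt c, sqrt w) and (sqrt c A, sqrt B). *)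
Lemma CS2 (d A c w B r : R) : 0 <= d -> 0 <= A -> 0 < c -> 0 <= w -> 0 <= B ->
  0 <= r -> r ^+ 2 = w * B ->
  (d * A + r) ^+ 2 <= (d ^+ 2 / c + w) * (c * A ^+ 2 + B).
Proof.
move=> d0 A0 c0 w0 B0 r0 rE; rewrite -subr_ge0.
set X := d ^+ 2 * B / c; set Z := w * c * A ^+ 2.
have -> : (d ^+ 2 / c + w) * (c * A ^+ 2 + B) - (d * A + r) ^+ 2 =
    X + Z - 2 * (d * A * r) + (w * B - r ^+ 2).
  by rewrite /X /Z; field; rewrite gt_eqF.
rewrite rE subrr addr0 subr_ge0.
have X0 : 0 <= X by rewrite divr_ge0 ?mulr_ge0 ?sqr_ge0 // ltW.
have Z0 : 0 <= Z by rewrite !mulr_ge0 ?sqr_ge0 // ltW.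
have L0 : 0 <= 2 * (d * A * r) by rewrite !mulr_ge0.
rewrite -(ler_pXn2r (ltn0Sn 1)) ?nnegrE ?addr_ge0 //.
have XZ : (d * A * r) ^+ 2 = X * Z.
  by rewrite exprMn rE /X /Z; field; rewrite gt_eqF.
by rewrite exprMn XZ; have := sqr_ge0 (X - Z); lra.
Qed.

(** With b^2 = u^2 - v^2, the squared cost is at most 3 (u^6 - v^6), a difference of cubes. Since (e
    + q)^3 - q^3 increases with [q], the bound [G * v ^+ 2 <= s'] allows [s'] in place of [q]. *)
Lemma tail_step (G b u v s s' : R) : 0 <= G -> 0 <= v -> 0 <= u ->
  u ^+ 2 = b ^+ 2 + v ^+ 2 -> G * v ^+ 2 <= s' -> s = G * b ^+ 2 + s' ->
  G ^+ 3 * (b * (u ^+ 2 + u * v + v ^+ 2)) ^+ 2 + 3 * s' ^+ 3 <= 3 * s ^+ 3.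
Proof.
move=> G0 v0 u0 uE Gv ->.
set e := G * b ^+ 2; set q := G * v ^+ 2 in Gv.
have e0 : 0 <= e by rewrite mulr_ge0 ?sqr_ge0.
have q0 : 0 <= q by rewrite mulr_ge0 ?sqr_ge0.
have H : (e + q) ^+ 3 - q ^+ 3 <= (e + s') ^+ 3 - s' ^+ 3.
  rewrite -subr_ge0.
  have -> : (e + s') ^+ 3 - s' ^+ 3 - ((e + q) ^+ 3 - q ^+ 3)
    = 3 * e * (s' - q) * (e + s' + q) by ring.
  have s'0 := le_trans q0 Gv.
  have sq0 : 0 <= s' - q by rewrite subr_ge0.
  have es : 0 <= e + s' + q by rewrite addr_ge0 // addr_ge0.
  by apply: mulr_ge0 => //; apply: mulr_ge0 => //; apply: mulr_ge0.
have eq : (e + q) ^+ 3 - q ^+ 3 = G ^+ 3 * (u ^+ 6 - v ^+ 6).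
  have -> : u ^+ 6 = (u ^+ 2) ^+ 3 by ring.
  by rewrite /e /q uE; ring.
have Y : (b * (u ^+ 2 + u * v + v ^+ 2)) ^+ 2 <= 3 * (u ^+ 6 - v ^+ 6).
  have bE : b ^+ 2 = u ^+ 2 - v ^+ 2 by rewrite uE addrK.
  have -> : 3 * (u ^+ 6 - v ^+ 6) =
     b ^+ 2 * (3 * (u ^+ 4 + u ^+ 2 * v ^+ 2 + v ^+ 4)) by rewrite bE; ring.
  rewrite exprMn; apply: ler_wpM2l; first exact: sqr_ge0.
  rewrite -subr_ge0.
  have -> : 3 * (u ^+ 4 + u ^+ 2 * v ^+ 2 + v ^+ 4) -
    (u ^+ 2 + u * v + v ^+ 2) ^+ 2 = 2 * (u - v) ^+ 2 * (u ^+ 2 + u * v + v ^+ 2).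
    by ring.
  have uv := mulr_ge0 u0 v0.
  by apply: mulr_ge0; rewrite ?addr_ge0 ?sqr_ge0 // mulr_ge0 ?sqr_ge0.
have G3 : 0 <= G ^+ 3 by exact: exprn_ge0.
have := ler_wpM2l G3 Y.
have -> : G ^+ 3 * (3 * (u ^+ 6 - v ^+ 6)) = 3 * ((e + q) ^+ 3 - q ^+ 3).
  by rewrite eq; ring.
move: H; move: (_ - q ^+ 3) ((e + s') ^+ 3) (s' ^+ 3) (G ^+ 3 * _) => *; lra.
Qed.

Lemma tail_weight_ge0 m : (5 <= m)%N -> 0 <= tail_weight m.
Proof.
move=> m5; have x5 : (5 : R) <= m%:R by rewrite ler_nat.
rewrite /tail_weight divr_ge0 // mulr_ge0 //; first by lra.
have -> : (m%:R + 1 / 2) ^+ 2 - 7 = (m%:R - 5) * (m%:R + 6) + 93 / 4 :> R by field.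
by apply: addr_ge0; [rewrite mulr_ge0 //; lra|lra].
Qed.

End Tail.

(** * Sorting the triples by their smallest index *)

Section Arrays.
(* [a k] stands for the 2-norm of the component [u_k] and [t i j k] for
   [Re h(u_i u_j u_k)] or its opposite. *)
Variables (R : rcfType) (N : nat) (a : nat -> R) (t : nat -> nat -> nat -> R).
Hypothesis N_ge : (10 <= N)%N.
Hypothesis a_ge0 : forall k, 0 <= a k.
Hypothesis t12 : forall i j k, t i j k = t j i k.
Hypothesis t23 : forall i j k, t i j k = t i k j.
Hypothesis t_tri : forall i j k, (i + j < k)%N -> t i j k = 0.
Hypothesis t_odd : forall i j k, odd (i + j + k) -> t i j k = 0.
Hypothesis t_coup : forall i j l, (l <= minn i j)%N ->
  (fusion_index i j l).+1%:R * t i j (fusion_index i j l) ^+ 2 <=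
  i.+1%:R * j.+1%:R * a i ^+ 2 * a j ^+ 2 * a (fusion_index i j l) ^+ 2.
Hypothesis t_op : forall i m m' (P Q : pred nat),
  \sum_(m <= j < N | P j) \sum_(m' <= k < N | Q k) t i j k <=
  i.+1%:R * a i * Num.sqrt (\sum_(m <= j < N | P j) a j ^+ 2)
    * Num.sqrt (\sum_(m' <= k < N | Q k) a k ^+ 2).

(** In the application [tau 1] is S^2 and [sig 1] is Q^2. The digit in [T2], [T1] and [T0] counts
    the fixed indices; the others run from a cutoff. *)
Definition tau m := \sum_(m <= k < N) a k ^+ 2.
Definition sig m := \sum_(m <= k < N) gap R k * a k ^+ 2.
Definition T2 i j m := \sum_(m <= k < N) t i j k.
Definition T1 i m m' := \sum_(m <= j < N) \sum_(m' <= k < N) t i j k.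
Definition T0 m := \sum_(m <= i < N) \sum_(m <= j < N) \sum_(m <= k < N) t i j k.

Lemma T2S i j m : (m < N)%N -> T2 i j m = t i j m + T2 i j m.+1.
Proof. by move=> mN; rewrite /T2 big_ltn. Qed.

Lemma T2_0 i j m : (i + j < m)%N -> T2 i j m = 0.
Proof.
move=> ijm; rewrite /T2 big_nat_cond big1 // => k /andP[/andP[mk _] _].
by apply: t_tri; apply: leq_trans mk.
Qed.

Lemma T1C i m m' : T1 i m m' = T1 i m' m.
Proof.
rewrite /T1 exchange_big; apply: eq_bigr => j _; apply: eq_bigr => k _.
exact: t23.
Qed.

Lemma T1Sl i m m' : (m < N)%N -> T1 i m m' = T2 i m m' + T1 i m.+1 m'.
Proof. by move=> mN; rewrite /T1 big_ltn. Qed.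

Lemma T1S i m : (m < N)%N ->
  T1 i m m = t i m m + 2 * T2 i m m.+1 + T1 i m.+1 m.+1.
Proof.
move=> mN; rewrite T1Sl // T1C T1Sl // T2S //; ring.
Qed.

Lemma T0S m : (m < N)%N -> T0 m = T1 m m m + T1 m m m.+1 + T1 m m.+1 m.+1 + T0 m.+1.
Proof.
move=> mN; rewrite /T0 big_ltn //.
rewrite -/(T1 m m m) -!addrA; congr (_ + _).
have E i : \sum_(m <= j < N) \sum_(m <= k < N) t i j k
   = T2 i m m + T2 i m m.+1 + T1 i m.+1 m.+1.
  by rewrite -/(T1 i m m) T1S // [T2 i m m]T2S //; ring.
under eq_bigr do rewrite E; rewrite !big_split /= -!addrA; congr (_ + (_ + _)).
  rewrite /T2 /T1 exchange_big; apply: eq_bigr => j _; apply: eq_bigr => k _.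
  by rewrite t12 t23.
by rewrite /T1 /T2; apply: eq_bigr => j _; apply: eq_bigr => k _; rewrite t12.
Qed.

Lemma tauS m : (m < N)%N -> tau m = a m ^+ 2 + tau m.+1.
Proof. by move=> mN; rewrite /tau big_ltn. Qed.

Lemma sigS m : (m < N)%N -> sig m = gap R m * a m ^+ 2 + sig m.+1.
Proof. by move=> mN; rewrite /sig big_ltn. Qed.

Lemma tau_ge0 m : 0 <= tau m.
Proof. by apply: sumr_ge0 => k _; exact: sqr_ge0. Qed.

Lemma gap_ge0 m : (1 <= m)%N -> 0 <= gap R m.
Proof.
move=> m1; have m1' : (1 : R) <= m%:R by rewrite ler1n.
by rewrite /gap divr_ge0 // mulr_ge0 //; lra.
Qed.

Lemma gap_le m n : (1 <= m)%N -> (m <= n)%N -> gap R m <= gap R n.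
Proof.
move=> m1 mn; have m1' : (1 : R) <= m%:R by rewrite ler1n.
have mn' : (m%:R : R) <= n%:R by rewrite ler_nat.
rewrite /gap ler_pM2r ?invr_gt0 // ler_pM //; lra.
Qed.

Lemma gap_tau m : (1 <= m)%N -> gap R m * tau m <= sig m.
Proof.
move=> m1; rewrite /tau /sig mulr_sumr big_nat_cond [leRHS]big_nat_cond.
apply: ler_sum => k /andP[/andP[mk _] _].
by apply: ler_wpM2r; [exact: sqr_ge0|exact: gap_le].
Qed.

Lemma sig_ge0 m : (1 <= m)%N -> 0 <= sig m.
Proof.
by move=> m1; apply: le_trans (gap_tau m1); rewrite mulr_ge0 ?tau_ge0 ?gap_ge0.
Qed.

Lemma T1_le i m m' :
  T1 i m m' <= i.+1%:R * a i * Num.sqrt (tau m) * Num.sqrt (tau m').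
Proof. exact: t_op. Qed.

(* Peeling off the index [m] costs [m.+1 a_m (u^2 + u v + v^2)], where
   [u^2 = tau m] and [v^2 = tau m.+1]; since [a_m^2 = u^2 - v^2], the squares of
   these costs, weighted by [gap m ^ 3], telescope. *)
Lemma T0_tail m : (5 <= m)%N -> (m <= N)%N ->
  T0 m <= Num.sqrt (tail_weight R m * (3 * sig m ^+ 3)).
Proof.
(* Downward induction on [m], starting from the empty sum at [m = N]. *)
move=> m5 mN; rewrite -(subKn mN); move: (leq_subr m N).
have : (5 <= N - (N - m))%N by rewrite subKn.
elim: (N - m)%N => {m m5 mN} [|j IH] m5 jN.
  by rewrite subn0 /T0 big_geq // sqrtr_ge0.
set m := (N - j.+1)%N in m5 *.
have mN : (m < N)%N by rewrite /m ltn_subrL /= (leq_trans _ N_ge).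
have Em : (N - j = m.+1)%N by rewrite /m subnSK.
have m1 : (1 <= m)%N by apply: leq_trans m5.
rewrite Em in IH; have {}IH := IH (leqW m5) (ltnW jN).
set w' := tail_weight R m.+1 in IH; set B' := 3 * sig m.+1 ^+ 3 in IH.
have w'0 : 0 <= w' by apply: tail_weight_ge0; apply: leqW.
have B'0 : 0 <= B' by rewrite mulr_ge0 // exprn_ge0 // sig_ge0.
set u := Num.sqrt (tau m); set v := Num.sqrt (tau m.+1).
have u2 : u ^+ 2 = tau m by rewrite sqr_sqrtr ?tau_ge0.
have v2 : v ^+ 2 = tau m.+1 by rewrite sqr_sqrtr ?tau_ge0.
have step : T0 m <= m.+1%:R * (a m * (u ^+ 2 + u * v + v ^+ 2)) + Num.sqrt (w' * B').
  rewrite T0S //; have := T1_le m m m; have := T1_le m m m.+1.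
  by have := T1_le m m.+1 m.+1; rewrite -/u -/v; move: IH; lra.
apply: (le_trans step).
have G_gt0 : 0 < gap R m.
  have x5 : (5 : R) <= m%:R by rewrite ler_nat.
  by rewrite /gap divr_gt0 // mulr_gt0 //; lra.
have w0 : 0 <= tail_weight R m by exact: tail_weight_ge0.
have s0 : 0 <= sig m by exact: sig_ge0.
have uv0 : 0 <= a m * (u ^+ 2 + u * v + v ^+ 2).
  by rewrite mulr_ge0 // !addr_ge0 ?sqr_ge0 // mulr_ge0 ?sqrtr_ge0.
have RHS0 : 0 <= tail_weight R m * (3 * sig m ^+ 3).
  by apply: mulr_ge0 => //; apply: mulr_ge0 => //; apply: exprn_ge0.
have L0 : 0 <= m.+1%:R * (a m * (u ^+ 2 + u * v + v ^+ 2)) + Num.sqrt (w' * B').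
  by apply: addr_ge0; [apply: mulr_ge0|exact: sqrtr_ge0].
rewrite -(ler_pXn2r (ltn0Sn 1)) ?nnegrE ?sqrtr_ge0 //.
rewrite (sqr_sqrtr RHS0).
have G3 : 0 < gap R m ^+ 3 by rewrite exprn_gt0.
(* With the weight [gap R m ^+ 3] the bound splits into two factors, which telescope separately by
   [tail_weight_step] and [tail_step]. *)
apply: le_trans (CS2 _ uv0 G3 w'0 B'0 (sqrtr_ge0 _) (sqr_sqrtr _)) _ => //.
  exact: mulr_ge0.
apply: ler_pM.
- by rewrite addr_ge0 // divr_ge0 ?sqr_ge0 // ltW.
- by rewrite addr_ge0 // mulr_ge0 ?sqr_ge0 // ltW.
- exact: tail_weight_step.
apply: tail_step; rewrite ?sqrtr_ge0 //.
- exact: ltW.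
- by rewrite u2 v2 tauS.
- rewrite v2; apply: le_trans (gap_tau (leqW m1)).
  by apply: ler_wpM2r; [exact: tau_ge0|exact: gap_le].
by rewrite sigS.
Qed.

(** The triples are sorted by how many of their indices equal [m]; symmetry gives the weights 1, 3,
    3, 1. *)
Lemma T0_expand m : (m < N)%N ->
  T0 m = t m m m + 3 * T2 m m m.+1 + 3 * T1 m m.+1 m.+1 + T0 m.+1.
Proof.
by move=> mN; rewrite T0S // (T1S m mN) [T1 m m m.+1](T1Sl m m.+1 mN); ring.
Qed.

(** Here [c] is a rational upper bound of sqrt (d_i d_j / d_k), so that each use is settled by
    arithmetic. *)
Lemma t_le i j k (c : R) : 0 <= c ->
  (exists2 l, (l <= minn i j)%N & fusion_index i j l = k) ->
  i.+1%:R * j.+1%:R <= k.+1%:R * c ^+ 2 ->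
  t i j k <= c * a i * a j * a k.
Proof.
move=> c0 [l lij <-] ijk; apply: le_trans (ler_norm _) _.
have C0 : 0 <= c * a i * a j * a (fusion_index i j l) by rewrite !mulr_ge0.
rewrite -(ler_pXn2r (ltn0Sn 1)) ?nnegrE // real_normK ?num_real //.
have k0 : (0 : R) < (fusion_index i j l).+1%:R by rewrite ltr0n.
rewrite -(ler_pM2l k0); apply: (le_trans (t_coup lij)).
move: ijk (a_ge0 i) (a_ge0 j) (a_ge0 (fusion_index i j l)).
move: (i.+1%:R : R) (j.+1%:R : R) ((fusion_index i j l).+1%:R : R) => ni nj nk.
move: (a i) (a j) (a (fusion_index i j l)) => ai aj ak.
move=> ijk ai0 aj0 ak0; have A0 : 0 <= (ai * aj * ak) ^+ 2 by exact: sqr_ge0.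
by have := ler_wpM2r A0 ijk; congr (_ <= _); ring.
Qed.

(* Parity pairs even with odd indices only, which improves on the bound by
   [4 a_3 tau 4]. *)
Lemma T1_3_parity : T1 3 4 4 <= 463 / 1000 * a 3 * sig 4.
Proof.
pose so := \sum_(4 <= k < N | odd k) a k ^+ 2.
pose se := \sum_(4 <= k < N | ~~ odd k) a k ^+ 2.
have so0 : 0 <= so by apply: sumr_ge0 => k _; exact: sqr_ge0.
have se0 : 0 <= se by apply: sumr_ge0 => k _; exact: sqr_ge0.
have H : 7 * se + 32 / 3 * so <= sig 4.
  rewrite /sig (bigID odd) /= addrC; apply: lerD.
    rewrite mulr_sumr [leLHS]big_nat_cond [leRHS]big_nat_cond; apply: ler_sum => k.
    move=> /andP[/andP[k4 _] _]; apply: ler_wpM2r; first exact: sqr_ge0.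
    have -> : 7 = gap R 4 by rewrite /gap; field.
    exact: gap_le.
  rewrite mulr_sumr [leLHS]big_nat_cond [leRHS]big_nat_cond; apply: ler_sum => k.
  move=> /andP[/andP[k4 _] k_odd]; apply: ler_wpM2r; first exact: sqr_ge0.
  have -> : 32 / 3 = gap R 5 by rewrite /gap; field.
  apply: gap_le => //; rewrite ltn_neqAle k4 andbT.
  by apply: contraL k_odd => /eqP <-.
have E : T1 3 4 4 = 2 * \sum_(4 <= j < N | odd j) \sum_(4 <= k < N | ~~ odd k) t 3 j k.
  rewrite /T1 (bigID odd) /=.
  have -> : \sum_(4 <= j < N | odd j) \sum_(4 <= k < N) t 3 j k =
      \sum_(4 <= j < N | odd j) \sum_(4 <= k < N | ~~ odd k) t 3 j k.
    apply: eq_bigr => j jo; rewrite [LHS](bigID odd) /= [X in X + _]big1 ?add0r //.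
    by move=> k ko; apply: t_odd; rewrite !oddD jo ko.
  have -> : \sum_(4 <= j < N | ~~ odd j) \sum_(4 <= k < N) t 3 j k =
      \sum_(4 <= j < N | odd j) \sum_(4 <= k < N | ~~ odd k) t 3 j k.
    rewrite [RHS]exchange_big; apply: eq_bigr => j jo.
    rewrite [LHS](bigID odd) /= [X in _ + X]big1 ?addr0 //; last first.
      by move=> k ko; apply: t_odd; rewrite !oddD (negPf jo) (negPf ko).
    by apply: eq_bigr => k _; rewrite t23.
  by rewrite -mulr2n mulr_natl.
have := t_op 3 4 4 odd (fun k => ~~ odd k); rewrite -/so -/se.
set u := Num.sqrt so; set v := Num.sqrt se.
have u2 : u ^+ 2 = so by rewrite sqr_sqrtr.
have v2 : v ^+ 2 = se by rewrite sqr_sqrtr.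
(* 1728/100 is just below 2 sqrt (7 * 32/3), and 8 divided by it is below 463/1000. *)
have uv : 1728 / 100 * v * u <= sig 4.
  by apply: le_trans H; rewrite -u2 -v2; apply: quad_form_le; lra.
have : 8 * a 3 * u * v <= 463 / 1000 * a 3 * sig 4.
  have -> : 8 * a 3 * u * v = a 3 * (8 * (v * u)) by ring.
  have -> : 463 / 1000 * a 3 * sig 4 = a 3 * (463 / 1000 * sig 4) by ring.
  by apply: ler_wpM2l => //; lra.
rewrite E; lra.
Qed.

Local Ltac clear_local := clear -N_ge a_ge0 t12 t23 t_tri t_odd t_coup t_op.

Local Notation p := (a 1).
Local Notation y := (a 2).
Local Notation z := (a 3).
Local Notation x := (a 4).

Lemma array_cube_le : T0 1 <= 3 * tau 1 * Num.sqrt (sig 1) + Num.sqrt (sig 1) ^+ 3.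
Proof.
(* [N] is at least 10 so that all indices below 9 can be split off without boundary cases. *)
have lN m : (m <= 9)%N -> (m < N)%N by move=> m9; apply: leq_trans N_ge.
pose g := Num.sqrt (tau 5); pose s := Num.sqrt (sig 5).
pose r4 := Num.sqrt (sig 4); pose r := Num.sqrt (sig 3); pose q := Num.sqrt (sig 1).
have [g0 s0 r40 r0 q0] : [/\ 0 <= g, 0 <= s, 0 <= r4, 0 <= r & 0 <= q].
  by split; apply: sqrtr_ge0.
have g2 : g ^+ 2 = tau 5 by rewrite sqr_sqrtr ?tau_ge0.
have s2 : s ^+ 2 = sig 5 by rewrite sqr_sqrtr ?sig_ge0.
have [G1 G2 G3 G4] : [/\ gap R 1 = 0, gap R 2 = 5 / 3, gap R 3 = 4 & gap R 4 = 7].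
  by split; rewrite /gap; field.
have [G5 G6 G7 G8] :
    [/\ gap R 5 = 32 / 3, gap R 6 = 15, gap R 7 = 20 & gap R 8 = 77 / 3].
  by split; rewrite /gap; field.
have G9 : gap R 9 = 32 by rewrite /gap; field.
have r42 : r4 ^+ 2 = 7 * x ^+ 2 + s ^+ 2.
  by rewrite sqr_sqrtr ?sig_ge0 // sigS ?lN // G4 s2.
have r2 : r ^+ 2 = 4 * z ^+ 2 + r4 ^+ 2.
  by rewrite !sqr_sqrtr ?sig_ge0 // sigS ?lN // G3.
have q2 : q ^+ 2 = 5 / 3 * y ^+ 2 + r ^+ 2.
  rewrite !sqr_sqrtr ?sig_ge0 // sigS ?lN // G1 mul0r add0r.
  by rewrite sigS ?lN // G2.
have tau5 : g ^+ 2 = a 5 ^+ 2 + (a 6 ^+ 2 + (a 7 ^+ 2 + (a 8 ^+ 2 + tau 9))).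
  by rewrite g2 (tauS (lN 5 isT)) (tauS (lN 6 isT)) (tauS (lN 7 isT)) (tauS (lN 8 isT)).
have sig5 : s ^+ 2 = 32 / 3 * a 5 ^+ 2 + (15 * a 6 ^+ 2 + (20 * a 7 ^+ 2 +
     (77 / 3 * a 8 ^+ 2 + sig 9))).
  rewrite s2 (sigS (lN 5 isT)) (sigS (lN 6 isT)) (sigS (lN 7 isT)) (sigS (lN 8 isT)).
  by rewrite G5 G6 G7 G8.
have tau9 : 32 * tau 9 <= sig 9 by rewrite -G9; apply: gap_tau.
have [t90 sq5 sq6 sq7 sq8] : [/\ 0 <= tau 9, 0 <= a 5 ^+ 2, 0 <= a 6 ^+ 2,
    0 <= a 7 ^+ 2 & 0 <= a 8 ^+ 2] by split; rewrite ?sqr_ge0 ?tau_ge0.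
have a5g : a 5 ^+ 2 <= g ^+ 2.
  by move: tau5 sq5 sq6 sq7 sq8 t90; clear_local; lra.
have a56g : a 5 ^+ 2 + a 6 ^+ 2 <= g ^+ 2.
  by move: tau5 sq5 sq6 sq7 sq8 t90; clear_local; lra.
have gs6 : 32 / 3 * g ^+ 2 + 13 / 3 * a 6 ^+ 2 <= s ^+ 2 by lra.
have gs : 32 / 3 * g ^+ 2 <= s ^+ 2 by lra.
have a68 : 15 * a 6 ^+ 2 + 77 / 3 * a 8 ^+ 2 <= s ^+ 2 by lra.
have T15 i : T1 i 5 5 <= i.+1%:R * a i * g ^+ 2.
  by apply: (le_trans (T1_le _ _ _)); rewrite -/g expr2 mulrA.
(* [B5], [B4] and [B3] compare [T0 m] with the power 3/2 of [sig m]. The first constant exceeds sqrt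
   (3 * 24/341), from [T0_tail]; each later one is what the cubic inequality of its level
   delivers. *)
have B5 : T0 5 <= 46 / 100 * s ^+ 3.
  apply: (le_trans (T0_tail (leqnn 5) (ltnW (lN 5%N isT)))).
  have H0 : 0 <= 46 / 100 * s ^+ 3 by apply: mulr_ge0; [lra|exact: exprn_ge0].
  have -> : tail_weight R 5 = 24 / 341 by rewrite /tail_weight; field.
  have s6 : 0 <= s ^+ 6 by exact: exprn_ge0.
  have -> : 24 / 341 * (3 * sig 5 ^+ 3) = 72 / 341 * s ^+ 6 by rewrite -s2; ring.
  rewrite -(ler_pXn2r (ltn0Sn 1)) ?nnegrE ?sqrtr_ge0 //.
  rewrite sqr_sqrtr; last by apply: mulr_ge0 => //; lra.
  have -> : (46 / 100 * s ^+ 3) ^+ 2 = 529 / 2500 * s ^+ 6 by field.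
  by apply: ler_wpM2r => //; lra.
have B4 : T0 4 <= 58 / 100 * r4 ^+ 3.
  rewrite T0_expand ?lN // (T2S _ _ (lN 5 isT)) (T2S _ _ (lN 6 isT)).
  rewrite (T2S _ _ (lN 7 isT)) (T2S _ _ (lN 8 isT)) T2_0 //.
  rewrite [t 4 4 5]t_odd // [t 4 4 7]t_odd //.
  have := T15 4.
  have : t 4 4 4 <= 2237 / 1000 * x * x * x.
    by apply: t_le; [clear_local; lra|exists 2|clear_local; lra].
  have : t 4 4 6 <= 189 / 100 * x * x * a 6.
    by apply: t_le; [clear_local; lra|exists 3|clear_local; lra].
  have : t 4 4 8 <= 1667 / 1000 * x * x * a 8.
    by apply: t_le; [clear_local; lra|exists 4|clear_local; lra].
  (* Cauchy-Schwarz with the weights 15 and 77/3 of [a 6] and [a 8] in [sig 5], which is cheaper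
     than bounding each of them by [s]. *)
  have L : 189 / 100 * a 6 + 1667 / 1000 * a 8 <= 1766 / 3000 * s.
    have : 5670 / 1766 * a 6 + 5001 / 1766 * a 8 <= s.
      by apply: tangent_le s0 _ a68; clear_local; lra.
    by clear_local; lra.
  have := ler_wpM2l (mulr_ge0 (a_ge0 4) (a_ge0 4)) L.
  have := ler_wpM2l (a_ge0 4) gs.
  have := cubic4 (a_ge0 4) s0 r40 r42.
  move: B5; clear_local; lra.
have B3 : T0 3 <= 772 / 1000 * r ^+ 3.
  rewrite T0_expand ?lN // (T2S _ _ (lN 4 isT)) (T2S _ _ (lN 5 isT)).
  rewrite (T2S _ _ (lN 6 isT)) T2_0 //.
  rewrite [t 3 3 3]t_odd // [t 3 3 5]t_odd //.
  have := T1_3_parity.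
  have : t 3 3 4 <= 1789 / 1000 * z * z * x.
    by apply: t_le; [clear_local; lra|exists 2|clear_local; lra].
  have : t 3 3 6 <= 1512 / 1000 * z * z * a 6.
    by apply: t_le; [clear_local; lra|exists 3|clear_local; lra].
  have L : 1789 / 1000 * x + 1512 / 1000 * a 6 <= 781 / 1000 * r4.
    have H0 : 7 * x ^+ 2 + 15 * a 6 ^+ 2 <= r4 ^+ 2.
      by move: r42 gs6 gs a68 sq8; clear_local; lra.
    have : 1789 / 781 * x + 1512 / 781 * a 6 <= r4.
      by apply: tangent_le r40 _ H0; clear_local; lra.
    by clear_local; lra.
  have := ler_wpM2l (mulr_ge0 (a_ge0 3) (a_ge0 3)) L.
  have := cubic3 (a_ge0 3) r40 r0 r2.
  have -> : sig 4 = r4 ^+ 2 by rewrite sqr_sqrtr ?sig_ge0.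
  move: B4; clear_local; lra.
have B2 : T0 2 <= q ^+ 3 + 16 / 10 * y ^+ 2 * q.
  apply: le_trans (cubic2 (a_ge0 2) r0 q0 q2).
  rewrite T0_expand ?lN // (T2S _ _ (lN 3 isT)) (T2S _ _ (lN 4 isT)) T2_0 //.
  rewrite [t 2 2 3]t_odd // (T1S _ (lN 3 isT)) (T2S _ _ (lN 4 isT)).
  rewrite (T2S _ _ (lN 5 isT)) T2_0 // [t 2 3 4]t_odd //.
  rewrite (T1S _ (lN 4 isT)) (T2S _ _ (lN 5 isT)).
  rewrite (T2S _ _ (lN 6 isT)) T2_0 // [t 2 4 5]t_odd //.
  have := T15 2.
  have : t 2 2 2 <= 1733 / 1000 * y * y * y.
    by apply: t_le; [clear_local; lra|exists 1|clear_local; lra].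
  have : t 2 2 4 <= 1342 / 1000 * y * y * x.
    by apply: t_le; [clear_local; lra|exists 2|clear_local; lra].
  have : t 2 3 3 <= 1733 / 1000 * y * z * z.
    by apply: t_le; [clear_local; lra|exists 1|clear_local; lra].
  have : t 2 3 5 <= 1415 / 1000 * y * z * a 5.
    by apply: t_le; [clear_local; lra|exists 2|clear_local; lra].
  have : t 2 4 4 <= 1733 / 1000 * y * x * x.
    by apply: t_le; [clear_local; lra|exists 1|clear_local; lra].
  have : t 2 4 6 <= 1464 / 1000 * y * x * a 6.
    by apply: t_le; [clear_local; lra|exists 2|clear_local; lra].
  have r2' : r ^+ 2 = 4 * z ^+ 2 + (7 * x ^+ 2 + s ^+ 2) by rewrite r2 r42.
  have := quadratic2 (a_ge0 2) a56g gs6 r2'.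
  move: B3; clear_local; lra.
have B1 : T0 1 <= 3 * (1155 / 1000 * p * p * y) + 3 * (2 * (1225 / 1000 * p * y * z)
   + 2 * (1265 / 1000 * p * z * x) + 2 * (1291 / 1000 * p * x * a 5)
   + 2 * p * g ^+ 2) + T0 2.
  (* Tensoring with u^1 moves the index by one, so among the terms with the index 1 split off here
     only those [t 1 m m.+1] survive. *)
  rewrite T0_expand ?lN // (T2S _ _ (lN 2 isT)) T2_0 // [t 1 1 1]t_odd //.
  rewrite (T1S _ (lN 2 isT)) (T2S _ _ (lN 3 isT)) T2_0 // [t 1 2 2]t_odd //.
  rewrite (T1S _ (lN 3 isT)) (T2S _ _ (lN 4 isT)) T2_0 // [t 1 3 3]t_odd //.
  rewrite (T1S _ (lN 4 isT)) (T2S _ _ (lN 5 isT)) T2_0 // [t 1 4 4]t_odd //.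
  have := T15 1.
  have : t 1 1 2 <= 1155 / 1000 * p * p * y.
    by apply: t_le; [clear_local; lra|exists 1|clear_local; lra].
  have : t 1 2 3 <= 1225 / 1000 * p * y * z.
    by apply: t_le; [clear_local; lra|exists 1|clear_local; lra].
  have : t 1 3 4 <= 1265 / 1000 * p * z * x.
    by apply: t_le; [clear_local; lra|exists 1|clear_local; lra].
  have : t 1 4 5 <= 1291 / 1000 * p * x * a 5.
    by apply: t_le; [clear_local; lra|exists 1|clear_local; lra].
  clear_local; lra.
have q2' : q ^+ 2 = 5 / 3 * y ^+ 2 + (4 * z ^+ 2 + (7 * x ^+ 2 + s ^+ 2)).
  by rewrite q2 r2 r42.
(* The 14/10 y^2 in [quadratic1] is what remains of 3 y^2 after the 16/10 y^2 spent in [B2]. *)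
have := quadratic1 (a_ge0 1) q0 (a_ge0 2) (a_ge0 3) (a_ge0 4) (a_ge0 5) a5g gs q2'.
have -> : tau 1 = p ^+ 2 + (y ^+ 2 + (z ^+ 2 + (x ^+ 2 + g ^+ 2))).
  by rewrite g2 (tauS (lN 1 isT)) (tauS (lN 2 isT)) (tauS (lN 3 isT)) (tauS (lN 4 isT)).
rewrite -/q; move: B1 B2; clear_local; lra.
Qed.

End Arrays.

(** * Schur orthogonality and the Haar trace *)

Section QuantumGroup.
Variables (R : realType) (A AA : cstarAlgType R).
Variables (i1 i2 Delta : {lrmorphism A -> AA}) (h : {scalar A}).
Local Notation C := R[i].
Local Notation Re := complex.Re.
Hypothesis i1_star : star_hom i1.
Hypothesis i2_star : star_hom i2.
Hypothesis i12_comm : forall a b, i1 a * i2 b = i2 b * i1 a.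
Hypothesis Delta_star : star_hom Delta.
Hypothesis hh : haar_state i1 i2 Delta h.

Let h_state : state h. Proof. by case: hh. Qed.

Lemma corepE n (v : 'M[A]_n) i j : corep i1 i2 Delta v ->
  Delta (v i j) = \sum_k i1 (v i k) * i2 (v k j).
Proof.
move=> /(congr1 (fun M : 'M[AA]_n => M i j)); rewrite !mxE => ->.
by apply: eq_bigr => k _; rewrite !mxE.
Qed.

(* The average of [v M (adjmx w)] under [h], for a matrix unit [M]. *)
Lemma avg_intertwiner m n (v : 'M[A]_m) (w : 'M[A]_n) a b :
  unitary_rep i1 i2 Delta v -> unitary_rep i1 i2 Delta w ->
  intertwiner v w (\matrix_(i, j) h (v i a * star (w j b))).
Proof.
move=> [v_u v_c] [w_u w_c]; set X := \matrix_(i, j) _.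
have [_ [E1 [E2 [_ _ E2E E2D]]]] := hh.
(* Entrywise, this is the invariance of [h] under the slice map id (x) h, applied to the coproduct
   of [v i a * star (w j b)]. *)
suff E : v *m inmx A X *m adjmx w = inmx A X.
  rewrite /intertwiner -[X in _ = X *m _]E -mulmxA.
  by have [_ ->] := w_u; rewrite mulmx1.
apply/matrixP=> i j.
have D : Delta (v i a * star (w j b)) =
    \sum_c \sum_d i1 (v i c * star (w j d)) * i2 (v c a * star (w d b)).
  have DM x y : Delta (x * y) = Delta x * Delta y by exact: rmorphM.
  have i1M x y : i1 (x * y) = i1 x * i1 y by exact: rmorphM.
  have i2M x y : i2 (x * y) = i2 x * i2 y by exact: rmorphM.
  rewrite DM Delta_star !corepE // star_sum mulr_suml.
  apply: eq_bigr => c _; rewrite mulr_sumr; apply: eq_bigr => d _.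
  rewrite starM -i1_star -i2_star i1M i2M -!mulrA; congr (_ * _).
  by rewrite mulrA i12_comm -mulrA i12_comm.
rewrite inmxE [X i j]mxE -(E2D _).2 D linear_sum mxE.
under eq_bigr do rewrite mulmx_in mulr_suml.
rewrite exchange_big; apply: eq_bigr => c _; rewrite linear_sum.
by apply: eq_bigr => d _; rewrite E2E adjmxE mxE -scalerAl.
Qed.

Lemma orth_neq m n (v : 'M[A]_m) (w : 'M[A]_n) a b p q :
  unitary_rep i1 i2 Delta v -> unitary_rep i1 i2 Delta w ->
  (forall X, intertwiner v w X -> X = 0) ->
  h (v a b * star (w p q)) = 0.
Proof.
move=> vr wr /(_ _ (avg_intertwiner b q vr wr)).
by move=> /matrixP/(_ a p); rewrite !mxE.
Qed.

(** Averages of [v] against itself are scalar, which leaves a value depending on the column indices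
    only. Summing over the rows, unitarity of [conjmx v] evaluates it; this is where the Kac
    property gives the plain constant 1/n. *)
Lemma orth_eq n (v : 'M[A]_n) a b p q :
  unitary_rep i1 i2 Delta v -> unitary (conjmx v) -> irreducible v ->
  h (v a b * star (v p q)) = ((a == p) && (b == q))%:R / n%:R.
Proof.
move=> vr vc [n0 vi].
have Phi b' q' a' p' : h (v a' b' * star (v p' q')) =
    h (v a b' * star (v a q')) *+ (a' == p').
  have [c Ec] := vi _ (avg_intertwiner b' q' vr vr).
  move/matrixP: Ec => Ec; have := Ec a' p'; have := Ec a a.
  by rewrite !mxE eqxx mulr1n => -> ->.
have n_neq0 : n%:R != 0 :> C by rewrite pnatr_eq0 -lt0n.
apply: (mulIf n_neq0); rewrite divfK // Phi.
case: (a == p); last by rewrite mulr0n mul0r.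
rewrite mulr1n mulr_natr.
transitivity (\sum_(k < n) h (v k b * star (v k q))).
  by under eq_bigr do rewrite Phi eqxx mulr1n; rewrite sumr_const card_ord.
rewrite -(state_sum h); transitivity (h (b == q)%:R).
  congr (h _); rewrite -(unitary_col b q vc); apply: eq_bigr => k _.
  by rewrite !mxE starK.
by case: (b == q) => /=; [case: h_state|rewrite linear0].
Qed.

Lemma conj_rep n (v : 'M[A]_n) :
  corep i1 i2 Delta v -> corep i1 i2 Delta (conjmx v).
Proof.
move=> vc; apply/matrixP=> i j; rewrite !mxE Delta_star (corepE _ _ vc) star_sum.
by apply: eq_bigr => k _; rewrite starM !mxE -i1_star -i2_star i12_comm.
Qed.

Lemma conj_irreducible n (v : 'M[A]_n) : irreducible v -> irreducible (conjmx v).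
Proof.
move=> [n0 vi]; split=> // X /conj_intertwiner; rewrite conjAK => /vi[c Ec].
exists (Num.conj c); apply: (can_inj (@map_conjK _ _ _)).
by rewrite Ec map_scalar_mx /= conjCK.
Qed.

Variables (u1 : 'M[A]_2) (U : forall k, 'M[A]_k.+1).
Hypothesis u1_conj : unitary (conjmx u1).
Hypothesis hU : irreps i1 i2 Delta u1 U.
Local Notation coef := (coef U).

Lemma U_unitary k : unitary (U k). Proof. by case: hU => _ /(_ k) [[]]. Qed.
Lemma U_rep k : unitary_rep i1 i2 Delta (U k).
Proof. by case: hU => _ /(_ k) []. Qed.
Lemma U_irr k : irreducible (U k). Proof. by case: hU => _ /(_ k) []. Qed.

Lemma schur_U k l X : k <> l -> intertwiner (U k) (U l) X -> X = 0.
Proof.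
move=> kl; apply: schur_neq (U_unitary k) (U_unitary l) (U_irr k) (U_irr l) _.
by case: hU => _ _ inj _ _ /inj.
Qed.

Lemma fusion_blocks i j :
  exists (X : forall l : 'I_(minn i j).+1, 'M[C]_(_, (fusion_index i j l).+1))
    (Y : forall l : 'I_(minn i j).+1, 'M[C]_((fusion_index i j l).+1, _)),
    [/\ forall l, intertwiner (U i *t U j) (U _) (X l),
        forall l, Y l *m X l = 1%:M & \sum_l X l *m Y l = 1%:M].
Proof. by case: hU => _ _ _ _ /(_ i j) /equivalent_blocks. Qed.

Lemma U_conj_unitary k : unitary (conjmx (U k)).
Proof.
suff H n : forall k, (k <= n)%N -> unitary (conjmx (U k)) by exact: H.
have [[U0 U1] _ _ _ _] := hU.
elim: n => [|n IH] {}k; first rewrite leqn0 => /eqP->.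
  rewrite U0; apply: unitaryE => i j; rewrite big_ord1 !ord1 !mxE /=;
  by rewrite star1 ?star1 mulr1.
rewrite leq_eqVlt => /orP[/eqP->|]; last exact: IH.
case: n IH => [|n] IH; first by rewrite U1.
have [X [Y [XI YX _]]] := fusion_blocks n.+1 1.
(* The block [l = 1] of [U n.+1 *t U 1] is the top one, namely [U n.+2]. *)
have lmax : (1 < (minn n.+1 1).+1)%N by rewrite minnSS minn0.
have := XI (Ordinal lmax); have := YX (Ordinal lmax).
move: (X _) (Y _); rewrite /fusion_index /=.
have -> : (n.+1 - 1 + (1 - n.+1) + 1.*2 = n.+2)%N.
  by rewrite subSS subn0 subSS sub0n addn0 addn2.
move=> {}X {}Y {}YX {}XI.
apply: conj_unitary_sub (U_irr n.+2) XI _.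
- apply: tens_unitary; exact: U_unitary.
- by apply: tens_conj_unitary; [apply: IH|rewrite U1].
- exact: U_unitary.
apply: contra_eq_neq YX => ->; rewrite mulmx0 eq_sym.
by apply/eqP => /matrixP/(_ ord0 ord0); rewrite !mxE eqxx => /eqP; rewrite oner_eq0.
Qed.

Lemma h_U_neq k l a b p q : k <> l -> h (U k a b * star (U l p q)) = 0.
Proof.
move=> kl; apply: orth_neq (U_rep k) (U_rep l) _ => // X.
exact: schur_U.
Qed.

Lemma h_U_eq k a b p q :
  h (U k a b * star (U k p q)) = ((a == p) && (b == q))%:R / k.+1%:R.
Proof.
by apply: orth_eq (U_rep k) _ (U_irr k) => //; apply: U_conj_unitary.
Qed.

Lemma conjU_rep k : unitary_rep i1 i2 Delta (conjmx (U k)).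
Proof.
split; first exact: U_conj_unitary.
by apply: conj_rep => //; case: (U_rep k).
Qed.

Lemma h_conjU_neq k l a b p q : k <> l -> h (star (U k a b) * U l p q) = 0.
Proof.
move=> kl.
have := orth_neq a b p q (conjU_rep k) (conjU_rep l).
rewrite !mxE starK; apply => X /conj_intertwiner; rewrite !conjAK.
by move=> /(schur_U kl) E; rewrite -[X]map_conjK E map_mx0.
Qed.

Lemma h_conjU_eq k a b p q :
  h (star (U k a b) * U k p q) = ((a == p) && (b == q))%:R / k.+1%:R.
Proof.
have := orth_eq a b p q (conjU_rep k) _ (conj_irreducible (U_irr k)).
by rewrite !mxE starK; apply; rewrite conjAK; apply: U_unitary.
Qed.

(** * Coefficients, the algebra they span and the trace property *)

Lemma coef_add k (c d : 'M_k.+1) : coef (c + d) = coef c + coef d.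
Proof.
rewrite /Defs.coef -big_split; apply: eq_bigr => i _ /=; rewrite -big_split.
by apply: eq_bigr => j _; rewrite mxE scalerDl.
Qed.

Lemma coef_scale k a (c : 'M_k.+1) : coef (a *: c) = a *: coef c.
Proof.
rewrite /Defs.coef scaler_sumr; apply: eq_bigr => i _; rewrite scaler_sumr.
by apply: eq_bigr => j _; rewrite mxE scalerA.
Qed.

Lemma coef_delta k i j : coef (delta_mx i j) = U k i j.
Proof.
rewrite /Defs.coef (bigD1 i) //= [X in _ + X]big1 ?addr0; last first.
  by move=> p /negPf ne; rewrite big1 // => q _; rewrite mxE ne scale0r.
rewrite (bigD1 j) //= [X in _ + X]big1 ?addr0 ?mxE ?eqxx ?scale1r //.
by move=> p /negPf ne; rewrite mxE ne andbF scale0r.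
Qed.

Lemma coef_zero k : coef (0 : 'M_k.+1) = 0.
Proof. by rewrite -(scale0r 0) coef_scale scale0r. Qed.

Lemma V_U k i j : V U k (U k i j).
Proof. by exists (delta_mx i j); rewrite coef_delta. Qed.

Lemma VD k x y : V U k x -> V U k y -> V U k (x + y).
Proof. by move=> [c ->] [d ->]; exists (c + d); rewrite coef_add. Qed.

Lemma VZ k a x : V U k x -> V U k (a *: x).
Proof. by move=> [c ->]; exists (a *: c); rewrite coef_scale. Qed.

Lemma V_sum k I (r : seq I) (F : I -> A) :
  (forall i, V U k (F i)) -> V U k (\sum_(i <- r) F i).
Proof.
move=> VF; apply: (big_ind (V U k)) => //; last exact: VD.
by exists 0; rewrite coef_zero.
Qed.

Lemma V_coef k (c : 'M_k.+1) : V U k (coef c). Proof. by exists c. Qed.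

Lemma Pol_V k x : V U k x -> Pol U x.
Proof.
(* The size of the matrices depends on the level, so [c] is transported along [l = k]; all other
   levels get zero. *)
move=> [c ->]; exists k.+1, (fun l => if l =P k is ReflectT e then
  ecast m 'M_m.+1 (esym e) c else 0).
rewrite big_ord_recr /= big1 ?add0r.
  case: eqP => // e; by rewrite (eq_irrelevance e erefl).
move=> i _; have ne : nat_of_ord i <> k by move=> e; have := ltn_ord i; rewrite {1}e ltnn.
by case: eqP => [/ne//|_]; exact: coef_zero.
Qed.

Lemma PolD x y : Pol U x -> Pol U y -> Pol U (x + y).
Proof.
move=> [n [c ->]] [m [d ->]].
exists (maxn n m), (fun k => (if (k < n)%N then c k else 0) + (if (k < m)%N then d k else 0)).
under [RHS]eq_bigr do rewrite coef_add; rewrite big_split /=; congr (_ + _).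
  rewrite (big_ord_widen (maxn n m) (fun k => coef (c k))) ?leq_maxl //.
  by rewrite big_mkcond; apply: eq_bigr => k _; case: ifP => // _; rewrite coef_zero.
rewrite (big_ord_widen (maxn n m) (fun k => coef (d k))) ?leq_maxr //.
by rewrite big_mkcond; apply: eq_bigr => k _; case: ifP => // _; rewrite coef_zero.
Qed.

Lemma PolZ a x : Pol U x -> Pol U (a *: x).
Proof.
move=> [n [c ->]]; exists n, (fun k => a *: c k); rewrite scaler_sumr.
by apply: eq_bigr => k _; rewrite coef_scale.
Qed.

Lemma Pol0 : Pol U 0.
Proof. by exists 0%N, (fun k => 0); rewrite big_ord0. Qed.

Lemma Pol_sum I (r : seq I) (P : pred I) (F : I -> A) :
  (forall i, P i -> Pol U (F i)) -> Pol U (\sum_(i <- r | P i) F i).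
Proof. by move=> PF; apply: (big_ind (Pol U)) => //; [exact: Pol0|exact: PolD]. Qed.

Lemma Pol_ind (P : A -> Prop) : P 0 -> (forall x y, P x -> P y -> P (x + y)) ->
  (forall a x, P x -> P (a *: x)) -> (forall k i j, P (U k i j)) ->
  forall x, Pol U x -> P x.
Proof.
move=> P0 PD PZ PU x [n [c ->]]; apply: (big_ind P) => // k _.
by apply: (big_ind P) => // i _; apply: (big_ind P) => // j _; apply: PZ.
Qed.

(** The conjugate of [U k] is an irreducible unitary representation, hence equivalent to some [U l],
    and comparing dimensions forces [l = k]. *)
Lemma star_V k x : V U k x -> V U k (star x).
Proof.
move=> [c ->]; rewrite star_sum; apply: V_sum => i; rewrite star_sum.
apply: V_sum => j; rewrite starZ; apply: VZ.
have [_ _ _ classif _] := hU.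
have [l [X [Y [XY YX XI]]]] := classif _ _
  (conjU_rep k) (conj_irreducible (U_irr k)).
have dim_le m n (M : 'M[C]_(m, n)) (N : 'M[C]_(n, m)) : M *m N = 1%:M -> (m <= n)%N.
  move=> MN; have := mxrankM_maxl M N; rewrite MN mxrank1 => /leq_trans; apply.
  exact: rank_leq_col.
have lk : l = k.
  apply/eqP; rewrite eqn_leq -[(l <= k)%N]ltnS -[(k <= l)%N]ltnS.
  by rewrite (dim_le _ _ _ _ YX) (dim_le _ _ _ _ XY).
move: X Y XY YX XI; rewrite {}lk => X Y XY YX XI.
have -> : star (U k i j) = (inmx A X *m U k *m inmx A Y) i j.
  by rewrite -XI -mulmxA -inmxM XY inmx1 mulmx1 mxE.
rewrite mulmx_in; apply: V_sum => q; apply: VZ; rewrite in_mulmx.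
by apply: V_sum => p; apply: VZ; apply: V_U.
Qed.

Lemma star_Pol x : Pol U x -> Pol U (star x).
Proof.
move: x; apply: Pol_ind => [|x y|a x|k i j].
- by rewrite star0; apply: Pol0.
- by rewrite starD; apply: PolD.
- by rewrite starZ; apply: PolZ.
by apply: Pol_V; apply: star_V; apply: V_U.
Qed.

(** The orthogonality relations for [U] and for its conjugates give the same value for both orders
    of a coefficient and a starred coefficient; linearity does the rest. *)
Lemma h_trace x y : Pol U x -> Pol U y -> h (x * y) = h (y * x).
Proof.
move=> Px Py; rewrite -(starK y); move: (star y) (star_Pol Py) => {Py}y Py.
move: x Px y Py.
apply: Pol_ind => [|x y Hx Hy z Pz|a x Hx z Pz|k i j].
- by move=> z _; rewrite mul0r mulr0.
- by rewrite mulrDl mulrDr !(stateD h) Hx // Hy.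
- by rewrite -scalerAl -scalerAr !(stateZ h) Hx.
apply: Pol_ind => [|x y Hx Hy|a x Hx|l p q].
- by rewrite star0 mul0r mulr0.
- by rewrite starD mulrDl mulrDr !(stateD h) Hx Hy.
- by rewrite starZ -scalerAl -scalerAr !(stateZ h) Hx.
have [E|/eqP kl] := eqVneq k l.
  case: l / E p q => p q; rewrite h_U_eq h_conjU_eq.
  by rewrite (eq_sym i) (eq_sym j).
by rewrite h_U_neq // h_conjU_neq // => /esym.
Qed.

Lemma h_coef_neq k l (c : 'M_k.+1) (d : 'M_l.+1) : k <> l ->
  h (coef c * star (coef d)) = 0.
Proof.
move=> kl; rewrite /Defs.coef star_sum mulr_suml (state_sum h) big1 // => i _.
rewrite mulr_sumr (state_sum h) big1 // => p _.
rewrite star_sum mulr_suml (state_sum h) big1 // => j _.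
rewrite mulr_sumr (state_sum h) big1 // => q _.
rewrite starZ -scalerAl -scalerAr !(stateZ h).
by rewrite h_U_neq // !mulr0.
Qed.

Lemma h_coef_eq k (c d : 'M_k.+1) :
  h (coef c * star (coef d)) = (\sum_i \sum_j c i j * Num.conj (d i j)) / k.+1%:R.
Proof.
rewrite {1}/Defs.coef [X in h X]mulr_suml (state_sum h) [RHS]mulr_suml; apply: eq_bigr => i _.
rewrite [X in h X]mulr_suml (state_sum h) [RHS]mulr_suml; apply: eq_bigr => j _.
rewrite -scalerAl (stateZ h) -mulrA; congr (_ * _).
rewrite /Defs.coef star_sum mulr_sumr (state_sum h) (bigD1 i) //=.
rewrite [X in _ + X]big1 ?addr0; last first.
  move=> p pi; rewrite star_sum mulr_sumr (state_sum h) big1 // => q _.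
  rewrite starZ -scalerAr (stateZ h) h_U_eq.
  by rewrite eq_sym (negPf pi) mul0r mulr0.
rewrite star_sum mulr_sumr (state_sum h) (bigD1 j) //= [X in _ + X]big1 ?addr0; last first.
  move=> q qj; rewrite starZ -scalerAr (stateZ h) h_U_eq.
  by rewrite (eq_sym j) (negPf qj) andbF mul0r mulr0.
rewrite starZ -scalerAr (stateZ h) h_U_eq.
by rewrite !eqxx mul1r.
Qed.

Lemma h_coef_fro k (c : 'M_k.+1) : h (star (coef c) * coef c) = fro c / k.+1%:R.
Proof.
have Pc : Pol U (coef c) by apply: Pol_V; apply: V_coef.
have -> : h (star (coef c) * coef c) = h (coef c * star (coef c)).
  by apply: h_trace => //; exact: star_Pol.
rewrite h_coef_eq.
congr (_ / _); apply: eq_bigr => i _; apply: eq_bigr => j _.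
by rewrite normCK.
Qed.

(* Cauchy-Schwarz over the pairs [(i, j)]: unitarity gives
   [sum_(i, j) |U_ij y|^2 = k.+1 |y|^2]. *)
Lemma op_bound k x y z : V U k x ->
  `|h (star z * (x * y))| ^+ 2 <=
  k.+1%:R ^+ 2 * h (star x * x) * h (star y * y) * h (star z * z).
Proof.
move=> [c ->]; rewrite h_coef_fro.
have hge0 w : 0 <= h (star w * w) by case: h_state.
have E : h (star z * (coef c * y)) =
    \sum_(p : 'I_k.+1 * 'I_k.+1) c p.1 p.2 * h (star z * (U k p.1 p.2 * y)).
  rewrite -(pair_bigA _ (fun i j => c i j * h (star z * (U k i j * y)))) /=.
  rewrite /Defs.coef mulr_suml mulr_sumr (state_sum h); apply: eq_bigr => i _.
  rewrite mulr_suml mulr_sumr (state_sum h); apply: eq_bigr => j _.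
  by rewrite -scalerAl -scalerAr (stateZ h).
rewrite E; apply: (le_trans (sum_CS _ _)).
have -> : \sum_(p : 'I_k.+1 * 'I_k.+1) `|c p.1 p.2| ^+ 2 = fro c.
  by rewrite -(pair_bigA _ (fun i j => `|c i j| ^+ 2)).
have -> : k.+1%:R ^+ 2 * (fro c / k.+1%:R) * h (star y * y) * h (star z * z)
   = fro c * (k.+1%:R * h (star y * y) * h (star z * z)).
  by field; rewrite nat1r pnatr_eq0.
apply: ler_wpM2l; first exact: fro_ge0.
have -> : k.+1%:R * h (star y * y) * h (star z * z) =
   \sum_(p : 'I_k.+1 * 'I_k.+1)
     h (star (U k p.1 p.2 * y) * (U k p.1 p.2 * y)) * h (star z * z).
  rewrite -mulr_suml; congr (_ * _).
  rewrite -(pair_bigA _ (fun i j => h (star (U k i j * y) * (U k i j * y)))) /=.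
  rewrite exchange_big /=.
  under eq_bigr => j _.
    rewrite -(state_sum h).
    under eq_bigr do rewrite starM -mulrA (mulrA (star (U k _ _))).
    rewrite -mulr_sumr -mulr_suml (unitary_col _ _ (U_unitary k)) eqxx mul1r.
    over.
  by rewrite sumr_const card_ord mulr_natl.
by apply: ler_sum => p _; apply: (le_trans (state_CS h_state _ _)).
Qed.

(** Inserting the resolution of the identity writes [U i *t U j] as the sum of the
    [X l *m U _ *m Y l]. The transposes arise because [coef c] pairs [c] with [U] entry by entry. *)
Lemma coef_mul i j (c : 'M_i.+1) (d : 'M_j.+1)
    (X : forall l : 'I_(minn i j).+1, 'M[C]_(i.+1 * j.+1, (fusion_index i j l).+1))
    (Y : forall l : 'I_(minn i j).+1, 'M[C]_((fusion_index i j l).+1, i.+1 * j.+1)) :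
  (forall l, intertwiner (U i *t U j) (U _) (X l)) ->
  \sum_l X l *m Y l = 1%:M ->
  coef c * coef d = \sum_l coef ((X l)^T *m (c *t d) *m (Y l)^T).
Proof.
move=> XI XY.
have W p q : (U i *t U j) p q = \sum_l \sum_a \sum_b (X l p a * Y l b q) *: U _ a b.
  rewrite -[U i *t U j]mulmx1 -inmx1 -XY.
  have -> : inmx A (\sum_l X l *m Y l) = \sum_l inmx A (X l) *m inmx A (Y l).
    by rewrite /inmx map_mx_sum; apply: eq_bigr => l _; apply: inmxM.
  rewrite mulmx_sumr summxE; apply: eq_bigr => l _.
  rewrite mulmxA XI mulmx_in.
  under eq_bigr do rewrite in_mulmx scaler_sumr.
  rewrite exchange_big; apply: eq_bigr => a _; apply: eq_bigr => b _.
  by rewrite scalerA mulrC.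
have -> : coef c * coef d = \sum_p \sum_q (c *t d) p q *: (U i *t U j) p q.
  rewrite sum_tens_index /Defs.coef mulr_suml; apply: eq_bigr => a _.
  rewrite mulr_sumr; under eq_bigr do rewrite mulr_suml.
  apply: eq_bigr => a' _; rewrite sum_tens_index; apply: eq_bigr => b _.
  rewrite mulr_sumr; apply: eq_bigr => b' _.
  by rewrite !tensmxE -scalerAl -scalerAr scalerA.
under eq_bigr => p _ do under eq_bigr => q _ do rewrite W scaler_sumr.
under eq_bigr => p _ do rewrite exchange_big.
rewrite exchange_big; apply: eq_bigr => l _; rewrite /Defs.coef.
under eq_bigr => p _ do under eq_bigr => q _ do rewrite scaler_sumr.
under eq_bigr => p _ do rewrite exchange_big.
rewrite exchange_big; apply: eq_bigr => a _.
under eq_bigr => p _ do under eq_bigr => q _ do rewrite scaler_sumr.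
under eq_bigr => p _ do rewrite exchange_big.
rewrite exchange_big; apply: eq_bigr => b _.
rewrite mxE scaler_suml exchange_big; apply: eq_bigr => q _.
rewrite mxE mulr_suml scaler_suml; apply: eq_bigr => p _.
by rewrite scalerA !mxE; congr (_ *: _); ring.
Qed.

Lemma PolM x y : Pol U x -> Pol U y -> Pol U (x * y).
Proof.
move=> + Py; move: x; apply: Pol_ind => [|x x' Hx Hx'|a x Hx|i p q].
- by rewrite mul0r; apply: Pol0.
- by rewrite mulrDl; apply: PolD.
- by rewrite -scalerAl; apply: PolZ.
move: y Py; apply: Pol_ind => [|x x' Hx Hx'|a x Hx|j p' q'].
- by rewrite mulr0; apply: Pol0.
- by rewrite mulrDr; apply: PolD.
- by rewrite -scalerAr; apply: PolZ.
have [X [Y [XI _ XY]]] := fusion_blocks i j.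
rewrite -!coef_delta (coef_mul _ _ XI XY).
by apply: Pol_sum => l _; apply: Pol_V; apply: V_coef.
Qed.

Lemma coupling0 i j k x y z : V U i x -> V U j y -> V U k z ->
  (forall l, (l <= minn i j)%N -> fusion_index i j l <> k) ->
  h (x * y * star z) = 0.
Proof.
move=> [c ->] [d ->] [e ->] nk.
have [X [Y [XI _ XY]]] := fusion_blocks i j.
rewrite (coef_mul _ _ XI XY) mulr_suml (state_sum h) big1 // => l _.
apply: h_coef_neq.
by apply: nk; rewrite -ltnS.
Qed.

(* Distinct blocks are inequivalent, so [X l] is a multiple of an isometry with
   [Y l] proportional to its adjoint. *)
Lemma fusion_fro i j
    (X : forall l : 'I_(minn i j).+1, 'M[C]_(i.+1 * j.+1, (fusion_index i j l).+1))
    (Y : forall l : 'I_(minn i j).+1, 'M[C]_((fusion_index i j l).+1, i.+1 * j.+1)) l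
    (K : 'M_(i.+1 * j.+1)) :
  (forall l, intertwiner (U i *t U j) (U _) (X l)) ->
  (forall l, Y l *m X l = 1%:M) ->
  \sum_l X l *m Y l = 1%:M ->
  fro ((X l)^T *m K *m (Y l)^T) <= fro K.
Proof.
move=> XI YX XY.
have Wu : unitary (U i *t U j) by apply: tens_unitary; apply: U_unitary.
have XlI := adj_intertwiner Wu (U_unitary _) (XI l).
have [b Eb] := (U_irr _).2 _ (comp_intertwiner XlI (XI l)).
have X0 : X l != 0.
  apply: contra_eq_neq (YX l) => ->; rewrite mulmx0 eq_sym.
  by apply/eqP => /matrixP/(_ ord0 ord0); rewrite !mxE eqxx => /eqP; rewrite oner_eq0.
have b_gt0 : 0 < b.
  have : 0 < fro (X l).
    rewrite lt_def fro_ge0 andbT; apply: contraNneq X0 => X0.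
    by apply/eqP/ctrmx_mul_eq0; rewrite -fro_tr.
  by rewrite fro_tr Eb mxtrace_scalar pmulrn_lgt0.
have YE : ctrmx (X l) = b *: Y l.
  rewrite -[LHS]mulmx1 -XY mulmx_sumr (bigD1 l) //= [X in _ + X]big1 ?addr0.
    by rewrite mulmxA Eb mul_scalar_mx.
  move=> m ml; rewrite mulmxA.
  rewrite (schur_U _ (comp_intertwiner XlI (XI m))) ?mul0mx //.
  by move=> /fusion_index_inj /val_inj /esym /eqP; rewrite (negPf ml).
have XX : (X l)^T *m ctrmx (X l)^T = b%:M.
  have -> : ctrmx (X l)^T = (ctrmx (X l))^T by apply/matrixP => p q; rewrite !mxE.
  by rewrite -trmx_mul Eb tr_scalar_mx.
have b0 : b != 0 by rewrite gt_eqF.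
have YY : Y l *m ctrmx (Y l) = (b^-1)%:M.
  have YE' : Y l = b^-1 *: ctrmx (X l) by rewrite YE scalerA mulVf // scale1r.
  rewrite {2}YE' ctrmxZ ctrmxK -scalemxAr YX scale_scalar_mx mulr1.
  by rewrite cj_ge0 // invr_ge0 ltW.
(* Multiplication by the transpose of [X l] costs a factor [b], by that of [Y l] a factor [b^-1],
   and these cancel. *)
rewrite -mulmxA -fro_trmx trmx_mul trmx_mul trmxK -mulmxA.
have b'0 : 0 < b^-1 by rewrite invr_gt0.
apply: (le_trans (fro_mul_le _ b'0 YY)).
rewrite -fro_trmx trmx_mul !trmxK -ler_pdivlMl ?invr_gt0 // invrK.
by apply: fro_mul_le.
Qed.

(** By orthogonality only one block of the product pairs with [z]. Its matrix is no larger than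
    [c *t d], and Cauchy-Schwarz applies to the pairing; the dimensions come from [h_coef_fro]. *)
Lemma coupling i j l x y z : V U i x -> V U j y -> V U (fusion_index i j l) z ->
  (l <= minn i j)%N ->
  (fusion_index i j l).+1%:R * `|h (x * y * star z)| ^+ 2 <=
   i.+1%:R * j.+1%:R * h (star x * x) * h (star y * y) * h (star z * z).
Proof.
move=> [c ->] [d ->] [e ->] lij.
have [X [Y [XI YX XY]]] := fusion_blocks i j.
pose l' : 'I_(minn i j).+1 := Ordinal (lij : (l < (minn i j).+1)%N).
rewrite (coef_mul _ _ XI XY) mulr_suml (state_sum h) (bigD1 l') //=.
rewrite [X in _ + X]big1 ?addr0; last first.
  move=> m ml; apply: h_coef_neq.
  by move=> /fusion_index_inj E; move: ml; rewrite -(inj_eq val_inj) /= E eqxx.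
have := fusion_fro l' (c *t d) XI YX XY; rewrite fro_tens.
move: ((X l')^T *m (c *t d) *m (Y l')^T) => K; rewrite /= in K * => KE.
rewrite h_coef_eq !h_coef_fro.
set n := (fusion_index i j l).+1; set s := \sum_i _.
have n0 : 0 < n%:R :> C by rewrite ltr0n.
have sle : `|s| ^+ 2 <= fro K * fro e.
  rewrite /s (pair_bigA _ (fun a b => K a b * Num.conj (e a b))) /=.
  apply: (le_trans (sum_CS _ _)); rewrite le_eqVlt; apply/orP; left; apply/eqP.
  rewrite -(pair_bigA _ (fun a b => `|K a b| ^+ 2)); congr (_ * _).
  rewrite -(pair_bigA _ (fun a b => `|Num.conj (e a b)| ^+ 2)).
  by apply: eq_bigr => a _; apply: eq_bigr => b _; rewrite norm_conjC.
rewrite normrM normfV normr_nat exprMn exprVn.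
have -> : n%:R * (`|s| ^+ 2 / n%:R ^+ 2) = `|s| ^+ 2 / n%:R.
  by field; rewrite gt_eqF.
have -> : i.+1%:R * j.+1%:R * (fro c / i.+1%:R) * (fro d / j.+1%:R) * (fro e / n%:R)
   = fro c * fro d * fro e / n%:R.
  by field; rewrite gt_eqF //= !nat1r !pnatr_eq0.
rewrite ler_pM2r ?invr_gt0 //; apply: (le_trans sle).
by rewrite ler_wpM2r // fro_ge0.
Qed.

(** * Self-adjoint elements *)

Section Components.
Variables (w : nat -> A) (N : nat).
Hypothesis N_ge : (10 <= N)%N.
Hypothesis w_V : forall k, V U k (w k).
Hypothesis w_sa : forall k, star (w k) = w k.

Definition nrm k : R := Num.sqrt (Re (h (w k * w k))).

(* The sign [e] yields the upper and the lower bound of [h (u ^+ 3)]. *)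
Definition tri (e : R) i j k : R := e * Re (h (w i * w j * w k)).

Let w_Pol k : Pol U (w k). Proof. exact: Pol_V (w_V k). Qed.

Lemma hww_ge0 k : 0 <= h (w k * w k).
Proof. by case: h_state => _ /(_ (w k)); rewrite w_sa. Qed.

Lemma nrm2 k : nrm k ^+ 2 = Re (h (w k * w k)).
Proof. by rewrite sqr_sqrtr // -lecR -Re_ge0 ?hww_ge0. Qed.

Lemma nrm2C k : (nrm k ^+ 2)%:C = h (w k * w k).
Proof. by rewrite nrm2 -Re_ge0 ?hww_ge0. Qed.

Lemma hww_neq j k : j <> k -> h (w j * w k) = 0.
Proof.
move=> jk; rewrite -(w_sa k); have [c ->] := w_V j; have [d ->] := w_V k.
exact: h_coef_neq.
Qed.

Lemma tri_rev e i j k : tri e i j k = tri e k j i.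
Proof.
rewrite /tri -(complexRe_conj (h _)) -(state_star h_state) !starM !w_sa.
by rewrite mulrA.
Qed.

(** The trace gives rotations, self-adjointness the reversal; together they generate all
    permutations of the indices. *)
Lemma tri_rot e i j k : tri e i j k = tri e k i j.
Proof. by rewrite /tri h_trace ?mulrA //; apply: PolM. Qed.

Lemma tri12 e i j k : tri e i j k = tri e j i k.
Proof. by rewrite tri_rot tri_rev tri_rot tri_rot. Qed.

Lemma tri23 e i j k : tri e i j k = tri e i k j.
Proof. by rewrite tri_rot tri12. Qed.

Lemma tri0 e i j k : (forall l, (l <= minn i j)%N -> fusion_index i j l <> k) ->
  tri e i j k = 0.
Proof.
move=> H; rewrite /tri -(w_sa k).
rewrite (coupling0 (w_V i) (w_V j) (w_V k)) //.
by rewrite mulr0.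
Qed.

Lemma tri_tri e i j k : (i + j < k)%N -> tri e i j k = 0.
Proof.
by move=> ijk; apply: tri0 => l /fusion_index_le H E; move: ijk; rewrite -E ltnNge H.
Qed.

Lemma tri_odd e i j k : odd (i + j + k) -> tri e i j k = 0.
Proof.
move=> ijk; apply: tri0 => l _ E; move: ijk.
by rewrite oddD -E fusion_index_odd addbb.
Qed.

Lemma tri_coup e i j l : e ^+ 2 = 1 -> (l <= minn i j)%N ->
  (fusion_index i j l).+1%:R * tri e i j (fusion_index i j l) ^+ 2 <=
  i.+1%:R * j.+1%:R * nrm i ^+ 2 * nrm j ^+ 2 * nrm (fusion_index i j l) ^+ 2.
Proof.
move=> e2 lij; rewrite /tri exprMn e2 mul1r; set k := fusion_index i j l.
have := coupling (w_V i) (w_V j) (w_V k) lij.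
rewrite !w_sa -!nrm2C -/k; have := Re_sqr_le (h (w i * w j * w k)).
move: (nrm i ^+ 2) (nrm j ^+ 2) (nrm k ^+ 2) (Re _ ^+ 2) (`|_| ^+ 2) => ni nj nk r c rc E.
rewrite -lecR !rmorphM /= !rmorph_nat; apply: le_trans E.
exact: ler_wpM2l.
Qed.

Lemma h_sum_w m (P : pred nat) (F : nat -> C) j : (m <= j < N)%N -> P j ->
  h (w j * (\sum_(m <= k < N | P k) F k *: w k)) = F j * (nrm j ^+ 2)%:C.
Proof.
move=> jmN Pj; rewrite mulr_sumr (state_sum h) nrm2C big_mkcond /=.
rewrite (bigD1_seq j) ?iota_uniq ?mem_index_iota //= Pj -scalerAr (stateZ h).
rewrite big1 ?addr0 // => k kj; case: (P k) => //.
by rewrite -scalerAr (stateZ h) hww_neq ?mulr0 // => /esym /eqP; rewrite (negPf kj).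
Qed.

Lemma h_sum_sqr m (P : pred nat) :
  h ((\sum_(m <= j < N | P j) w j) * (\sum_(m <= j < N | P j) w j)) =
  (\sum_(m <= j < N | P j) nrm j ^+ 2)%:C.
Proof.
rewrite mulr_suml (state_sum h) rmorph_sum /= big_nat_cond [RHS]big_nat_cond.
apply: eq_bigr => j /andP[jmN Pj].
rewrite -[RHS]mul1r -(h_sum_w (fun=> 1) jmN Pj).
by under [in RHS]eq_bigr do rewrite scale1r.
Qed.

Lemma star_sum_w m (P : pred nat) :
  star (\sum_(m <= j < N | P j) w j) = \sum_(m <= j < N | P j) w j.
Proof. by rewrite star_sum; apply: eq_bigr => j _. Qed.

Lemma Pol_sum_w m (P : pred nat) : Pol U (\sum_(m <= j < N | P j) w j).
Proof. by apply: Pol_sum. Qed.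

Lemma tri_op e i m m' (P Q : pred nat) : e ^+ 2 = 1 ->
  \sum_(m <= j < N | P j) \sum_(m' <= k < N | Q k) tri e i j k <=
  i.+1%:R * nrm i * Num.sqrt (\sum_(m <= j < N | P j) nrm j ^+ 2)
    * Num.sqrt (\sum_(m' <= k < N | Q k) nrm k ^+ 2).
Proof.
move=> e2; set X := \sum_(m <= j < N | P j) w j.
set Y := \sum_(m' <= k < N | Q k) w k.
have -> : \sum_(m <= j < N | P j) \sum_(m' <= k < N | Q k) tri e i j k
    = e * Re (h (star Y * (w i * X))).
  rewrite star_sum_w -/Y.
  (* The trace moves [Y] to the right end, which is the order of the factors in [tri]. *)
  rewrite (h_trace (Pol_sum_w m' Q) (PolM (w_Pol i) (Pol_sum_w m P))).
  rewrite /X /Y [w i * _]mulr_sumr mulr_suml (state_sum h) Re_sum mulr_sumr.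
  apply: eq_bigr => j _; rewrite mulr_sumr (state_sum h) Re_sum mulr_sumr.
  exact: eq_bigr.
apply: le_trans (ler_norm _) _.
set sX := \sum_(m <= j < N | P j) nrm j ^+ 2.
set sY := \sum_(m' <= k < N | Q k) nrm k ^+ 2.
have sX0 : 0 <= sX by apply: sumr_ge0 => *; exact: sqr_ge0.
have sY0 : 0 <= sY by apply: sumr_ge0 => *; exact: sqr_ge0.
have L0 : 0 <= i.+1%:R * nrm i * Num.sqrt sX * Num.sqrt sY.
  by apply: mulr_ge0; rewrite ?sqrtr_ge0 // !mulr_ge0 ?sqrtr_ge0.
rewrite -(ler_pXn2r (ltn0Sn 1)) ?nnegrE //.
rewrite real_normK ?num_real // !exprMn e2 mul1r (sqr_sqrtr sX0) (sqr_sqrtr sY0).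
rewrite -lecR; apply: (le_trans (Re_sqr_le _)).
have := op_bound X Y (w_V i).
move=> /le_trans; apply.
rewrite w_sa !star_sum_w !h_sum_sqr -nrm2C -/sX -/sY.
have -> : (i.+1%:R : C) ^+ 2 = (i.+1%:R ^+ 2)%:C by rewrite rmorphXn /= rmorph_nat.
by move: (nrm i ^+ 2) (i.+1%:R ^+ 2) => ? ?; rewrite -!rmorphM.
Qed.

Lemma h_cube_le :
  `|h ((\sum_(1 <= k < N) w k) ^+ 3)| <=
  (3 * (\sum_(1 <= k < N) nrm k ^+ 2) *
     Num.sqrt (\sum_(1 <= k < N) gap R k * nrm k ^+ 2) +
   Num.sqrt (\sum_(1 <= k < N) gap R k * nrm k ^+ 2) ^+ 3)%:C.
Proof.
set u := \sum_(1 <= k < N) w k; set S2 := \sum_(1 <= k < N) nrm k ^+ 2.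
set Q := Num.sqrt _.
have T e : e ^+ 2 = 1 -> e * Re (h (u ^+ 3)) <= 3 * S2 * Q + Q ^+ 3.
  move=> e2; have nrm_ge0 k : 0 <= nrm k by exact: sqrtr_ge0.
  have := array_cube_le N_ge nrm_ge0 (tri12 e) (tri23 e) (@tri_tri e) (@tri_odd e)
    (fun i j l => tri_coup e2) (fun i m m' P Q => @tri_op e i m m' P Q e2).
  rewrite /T0 -/S2; congr (_ <= _).
  rewrite /u 2!exprS expr1 mulr_suml (state_sum h) Re_sum mulr_sumr.
  apply: eq_bigr => i _.
  rewrite mulrA [w i * _]mulr_sumr mulr_suml (state_sum h) Re_sum mulr_sumr.
  apply: eq_bigr => j _; rewrite mulr_sumr (state_sum h) Re_sum mulr_sumr.
  exact: eq_bigr.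
have u_sa : star u = u by exact: star_sum_w.
(* [tri] sees only the real part, which is everything because [u] is self-adjoint. *)
have real : h (u ^+ 3) = (Re (h (u ^+ 3)))%:C.
  rewrite RRe_real // CrealE -(state_star h_state); apply/eqP; congr (h _).
  by rewrite !exprS expr0 mulr1 !starM u_sa mulrA.
rewrite real normc_def /= expr0n /= addr0 sqrtr_sqr lecR ler_norml.
have N1 : (-1 : R) ^+ 2 = 1 by rewrite sqrrN expr1n.
have := T 1 (expr1n _ _); have := T (-1) N1; rewrite mul1r mulN1r => *.
by rewrite lerNl; apply/andP.
Qed.

End Components.

(** The unit is a coefficient of [U 0], so this is orthogonality to [V 0]. *)
Lemma h_V k x : k != 0%N -> V U k x -> h x = 0.
Proof.
move=> k0 [c ->]; have [[U0 _] _ _ _ _] := hU.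
rewrite -[coef c]mulr1 -star1; have -> : (1 : A) = coef (delta_mx ord0 ord0 : 'M_1).
  by rewrite coef_delta U0 mxE eqxx.
apply: h_coef_neq; exact/eqP.
Qed.

Lemma V0_eq0 x : V U 0 x -> h x = 0 -> x = 0.
Proof.
move=> [c ->]; have [[U0 _] _ _ _ _] := hU; have [[h1 _] _] := hh.
rewrite /Defs.coef !big_ord1 U0 mxE eqxx (stateZ h) h1 mulr1 => ->.
by rewrite scale0r.
Qed.

(* The isotypic components of [(x + star x) / 2], padded by zeros. *)
Lemma sa_decomposition x : Pol U x -> x = star x -> h x = 0 ->
  exists (w : nat -> A) (N : nat), [/\ (10 <= N)%N, forall k, V U k (w k),
    forall k, star (w k) = w k & x = \sum_(1 <= k < N) w k].
Proof.
move=> [n [c xE]] x_sa hx.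
(* Averaging with the adjoint makes each component self-adjoint by construction, without an appeal
   to the uniqueness of the decomposition. *)
pose w k := if (k < n)%N then (2^-1 : C) *: (coef (c k) + star (coef (c k))) else 0.
have w_V k : V U k (w k).
  rewrite /w; case: ifP => _; last by exists 0; rewrite coef_zero.
  apply: VZ; apply: VD; first exact: V_coef.
  exact: (star_V (V_coef _)).
have w_sa k : star (w k) = w k.
  rewrite /w; case: ifP => _; last exact: star0.
  rewrite starZ starD starK addrC; congr (_ *: _).
  by apply: cj_ge0; rewrite invr_ge0.
have xw : x = \sum_(0 <= k < n + 10) w k.
  have half : x = (2^-1 : C) *: (x + star x).
    rewrite -x_sa -[X in X + _]scale1r -[X in _ + X]scale1r -scalerDl scalerA.
    by rewrite (_ : 2^-1 * (1 + 1) = 1) ?scale1r //; field.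
  rewrite (big_cat_nat (n := n)) ?leq_addr //= [X in _ + X]big_nat_cond.
  rewrite [X in _ + X]big1 ?addr0; last first.
    by move=> k /andP[/andP[nk _] _]; rewrite /w ltnNge nk.
  rewrite {1}half {1 2}xE star_sum -big_split /= scaler_sumr big_mkord.
  by apply: eq_bigr => k _; rewrite /w ltn_ord.
exists w, (n + 10)%N; split=> //; first by rewrite leq_addl.
(* The component of index 0 vanishes: it is a scalar, and [h] sends it to [h x = 0] since [h] kills
   all the others. *)
rewrite {1}xw big_ltn ?addn_gt0 ?orbT //.
rewrite (V0_eq0 (w_V 0%N)) ?add0r //.
move: hx; rewrite xw big_ltn ?addn_gt0 ?orbT // (stateD h) (state_sum h).
rewrite big_nat_cond big1 ?addr0 // => k /andP[/andP[k1 _] _].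
by apply: h_V (w_V k); rewrite -lt0n.
Qed.

Lemma L_sum (L : A -> A) (w : nat -> A) N : is_L 2 U L -> (forall k, V U k (w k)) ->
  L (\sum_(1 <= k < N) w k) = \sum_(1 <= k < N) alpha C 2 k *: w k.
Proof.
move=> [Llin LV] w_V.
have LD x y : Pol U x -> Pol U y -> L (x + y) = L x + L y.
  by move=> Px Py; have := Llin 1 x y Px Py; rewrite !scale1r.
have L0 : L 0 = 0.
  by apply: (@addrI _ (L 0)); rewrite -LD ?addr0 //; apply: Pol0.
elim: N => [|N IH]; first by rewrite !big_geq.
case: (ltnP 0 N) => N0; last by rewrite !big_geq.
rewrite !big_nat_recr //= LD; last exact: Pol_V (w_V N).
  by rewrite IH (LV _ _ (w_V N)).
by apply: Pol_sum => k _; apply: Pol_V (w_V k).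
Qed.

Lemma h_cube_Pol (L : A -> A) u (S Q : R) : is_L 2 U L ->
  Pol U u -> u = star u -> h u = 0 -> 0 <= S -> 0 <= Q ->
  S%:C ^+ 2 = h (u ^+ 2) -> Q%:C ^+ 2 = h (u * (L u - u)) ->
  `|h (u ^+ 3)| <= (3 * S ^+ 2 * Q + Q ^+ 3)%:C.
Proof.
move=> hL u_Pol u_sa hu0 S_ge0 Q_ge0 hS hQ.
have [w [N [N_ge w_V w_sa uE]]] := sa_decomposition u_Pol u_sa hu0.
have S2 : S ^+ 2 = \sum_(1 <= k < N) nrm w k ^+ 2.
  apply: complexI; rewrite rmorphXn /= hS expr2 uE.
  exact: (h_sum_sqr _ w_V w_sa).
have Q2 : Q ^+ 2 = \sum_(1 <= k < N) gap R k * nrm w k ^+ 2.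
  apply: complexI; rewrite rmorphXn /= hQ uE (L_sum _ hL w_V).
  have -> : \sum_(1 <= k < N) alpha R[i] 2 k *: w k - \sum_(1 <= k < N) w k =
      \sum_(1 <= k < N) (gap R k)%:C *: w k.
    rewrite -sumrB; apply: eq_bigr => k _; rewrite -[X in _ - X]scale1r -scalerBl.
    congr (_ *: _); rewrite alpha2E /gap !rmorphM /= fmorphV rmorphB rmorphD /=.
    by rewrite !rmorph_nat -natr1 -[k.+1%:R]natr1; field.
  rewrite mulr_suml (state_sum h) rmorph_sum /= big_nat_cond [RHS]big_nat_cond.
  apply: eq_bigr => j /andP[jN _].
  have := @h_sum_w w N w_V w_sa 1%N xpredT (fun k => (gap R k)%:C) j jN isT.
  by move=> ->; rewrite [RHS]rmorphM.
have := h_cube_le N_ge w_V w_sa.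
by rewrite -uE -S2 -Q2 sqrtr_sqr (ger0_norm Q_ge0).
Qed.

End QuantumGroup.

Theorem proposition4p2 (R : realType) (F : 'M[R[i]]_2) (eps : R[i])
    (heps : eps = 1 \/ eps = -1)
    (F_unit : F \in unitmx)
    (F_conj : F *m map_mx Num.conj F = eps%:M)
    (F_unitary : (map_mx Num.conj F)^T *m F = 1%:M)
    (A : cstarAlgType R) (u1 : 'M[A]_2) (hA : universal_OF F u1)
    (AA : cstarAlgType R) (i1 i2 : {lrmorphism A -> AA})
    (hAA : min_tensor i1 i2)
    (Delta : {lrmorphism A -> AA}) (Delta_star : star_hom Delta)
    (Delta_u1 : map_mx Delta u1 = map_mx i1 u1 *m map_mx i2 u1)
    (h : {scalar A}) (hh : haar_state i1 i2 Delta h)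
    (U : forall k, 'M[A]_k.+1) (hU : irreps i1 i2 Delta u1 U)
    (L : A -> A) (hL : is_L 2 U L)
    (u : A) (u_Pol : Pol U u) (u_sa : u = star u) (hu0 : h u = 0)
    (S Q : R) (S_ge0 : 0 <= S) (Q_ge0 : 0 <= Q)
    (hS : S%:C ^+ 2 = h (u ^+ 2))
    (hQ : Q%:C ^+ 2 = h (u * (L u - u))) :
  `|h (u ^+ 3)| <= (3 * S ^+ 2 * Q + Q ^+ 3)%:C.
Proof.
have [[i1_star i2_star i12_comm _] _ _] := hAA.
(* As [F] is unitary, the defining relation makes [conjmx u1] a conjugate of [u1] by a unitary
   scalar matrix. This starts the induction behind the trace property. *)
have u1_conj : unitary (conjmx u1).
  have [[u1_u u1E] _] := hA.
  have FF : ctrmx F *m F = 1%:M by [].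
  have FF' : F *m ctrmx F = 1%:M by apply: mulmx1C.
  have E : conjmx u1 = inmx A (ctrmx F) *m u1 *m inmx A F.
    have FI : invmx F = ctrmx F.
      by rewrite -[LHS]mul1mx -FF -mulmxA mulmxV // mulmx1.
    by rewrite [in RHS]u1E FI !mulmxA -inmxM FF inmx1 mul1mx -mulmxA -inmxM FF inmx1 mulmx1.
  have [uu' u'u] := u1_u.
  have adjE : adjmx (conjmx u1) = inmx A (ctrmx F) *m adjmx u1 *m inmx A F.
    by rewrite E !adjmxM -!inmx_ctr ctrmxK mulmxA.
  have mid (x y : 'M[A]_2) : x *m y = 1%:M ->
      inmx A (ctrmx F) *m x *m inmx A F *m (inmx A (ctrmx F) *m y *m inmx A F) = 1%:M.
    move=> xy; rewrite !mulmxA -(mulmxA _ (inmx A F)) -inmxM FF' inmx1 mulmx1.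
    by rewrite -(mulmxA _ x) xy mulmx1 -inmxM FF inmx1.
  by apply/unitaryP; rewrite adjE E; split; apply: mid.
exact: (h_cube_Pol i1_star i2_star i12_comm Delta_star hh u1_conj hU hL).
Qed.
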